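(* Let $\mathbb{K}\in\{\mathbb{R},\mathbb{C}\}$ and let $X,Y$ be normed spaces over $\mathbb{K}$. For every bounded linear operator $S\colon X\to Y$ and every $n\in\mathbb{N}_0$, \[ a_n(S)\;\le\; e\,(n+1)\,h_n(S). \] Moreover, if $X$ or $Y$ is a Hilbert space, then \[ a_n(S)\;\le\;\sqrt{e\,(n+1)}\;h_n(S). \] Here $a_n(S)$ and $h_n(S)$ denote the $n$-th approximation number and the $n$-th Hilbert number of $S$ (indexed from $n=0$).
   Context: $\mathcal{L}(X,Y)$ denotes the space of bounded linear operators from $X$ to $Y$ with the operator norm. $\ell_2$ is the Hilbert space of square-summable sequences over $\mathbb{K}$. For $S\in\mathcal{L}(X,Y)$ and $n\in\mathbb{N}_0=\{0,1,2,\dots\}$: Approximation numbers: $a_n(S):=\inf\{\|S-L\| : L\in\mathcal{L}(X,Y),\ \operatorname{rank}(L)\le n\}$. Hilbert numbers: $h_n(S):=\sup\{a_n(BSA) : A\in\mathcal{L}(\ell_2,X),\ B\in\mathcal{L}(Y,\ell_2),\ \|A\|\le 1,\ \|B\|\le1\}$, where $a_n(BSA)$ is the approximation number of $BSA\in\mathcal{L}(\ell_2,\ell_2)$. *)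

(* Defs.v *)
From HB Require Import structures.
From mathcomp Require Import all_boot all_order all_algebra.
From mathcomp Require Import sesquilinear complex ring.
From mathcomp Require Import all_classical all_reals all_analysis.

Set Implicit Arguments.
Unset Strict Implicit.
Unset Printing Implicit Defensive.

Import Order.TTheory GRing.Theory Num.Theory.
Import numFieldNormedType.Exports.

Local Open Scope classical_set_scope.
Local Open Scope ring_scope.

Variant scalars := RealScalars | ComplexScalars.

Definition scalar_field (R : realType) (s : scalars) : numFieldType :=
  match s with RealScalars => R | ComplexScalars => R[i] end.

Section Scalars.
Context {R : realType} {s : scalars}.
Local Notation K := (scalar_field R s).

Definition scalar_re : K -> R :=
  match s return scalar_field R s -> R with
  | RealScalars => idfun
  | ComplexScalars => @complex.Re R
  end.

Definition scalar_of_real : R -> K :=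
  match s return R -> scalar_field R s with
  | RealScalars => idfun
  | ComplexScalars => real_complex R
  end.

Definition scalar_conj : K -> K :=
  match s return scalar_field R s -> scalar_field R s with
  | RealScalars => idfun
  | ComplexScalars => @Num.conj R[i]
  end.

(* In a normedModType K the norm `|x| is an element of K, not of R. *)
Definition rnorm (V : normedModType K) (x : V) : R := scalar_re `|x|.

Lemma scalar_of_realK : cancel scalar_of_real scalar_re.
Proof. by rewrite /scalar_of_real /scalar_re; case: s. Qed.

Lemma scalar_of_realD x y :
  scalar_of_real (x + y) = scalar_of_real x + scalar_of_real y.
Proof. by rewrite /scalar_of_real; case: s => //; exact: rmorphD. Qed.

Lemma scalar_of_realM x y :
  scalar_of_real (x * y) = scalar_of_real x * scalar_of_real y.
Proof. by rewrite /scalar_of_real; case: s => //; exact: rmorphM. Qed.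

Lemma ler_scalar_of_real x y :
  (scalar_of_real x <= scalar_of_real y) = (x <= y).
Proof. by rewrite /scalar_of_real; case: s => //=; exact: lecR. Qed.

Lemma scalar_of_real0 : scalar_of_real 0 = 0.
Proof. by rewrite /scalar_of_real; case: s. Qed.

Lemma scalar_of_real_ge0 (z : K) : 0 <= z -> scalar_of_real (scalar_re z) = z.
Proof.
rewrite /scalar_of_real /scalar_re; case: s z => //= -[a b].
by rewrite lecE /= => /andP[/eqP -> _].
Qed.

Lemma rnormE (V : normedModType K) (x : V) : scalar_of_real (rnorm x) = `|x|.
Proof. exact: scalar_of_real_ge0. Qed.

Lemma rnorm_ge0 (V : normedModType K) (x : V) : 0 <= rnorm x.
Proof. by rewrite -ler_scalar_of_real rnormE scalar_of_real0. Qed.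

Lemma rnormD (V : normedModType K) (x y : V) :
  rnorm (x + y) <= rnorm x + rnorm y.
Proof. by rewrite -ler_scalar_of_real scalar_of_realD !rnormE ler_normD. Qed.

Lemma rnormZ (V : normedModType K) (a : K) (x : V) :
  rnorm (a *: x) = rnorm (a : K^o) * rnorm x.
Proof.
by apply: (can_inj scalar_of_realK); rewrite scalar_of_realM !rnormE normrZ.
Qed.

Lemma rnorm0 (V : normedModType K) : rnorm (0 : V) = 0.
Proof.
by apply: (can_inj scalar_of_realK); rewrite rnormE normr0 scalar_of_real0.
Qed.

Lemma rnorm_eq0 (V : normedModType K) (x : V) : rnorm x = 0 -> x = 0.
Proof. by move=> x0; apply: normr0_eq0; rewrite -rnormE x0 scalar_of_real0. Qed.

End Scalars.

Section L2.
Variables (R : realType) (s : scalars).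
Local Notation K := (scalar_field R s).

Definition sqseries (u : nat -> K^o) : R^nat :=
  series (fun i => rnorm (u i) ^+ 2).

Definition square_summable : {pred nat -> K^o} :=
  mem [set u | cvgn (sqseries u)].

Definition l2norm (u : nat -> K^o) : R := Num.sqrt (limn (sqseries u)).

Lemma sqseries_ge0 u n : 0 <= sqseries u n.
Proof. by rewrite /sqseries /series /= sumr_ge0 // => i _; rewrite sqr_ge0. Qed.

Lemma nondecreasing_sqseries u : nondecreasing_seq (sqseries u).
Proof. by apply: nondecreasing_series => n _ _; rewrite sqr_ge0. Qed.

Lemma sqseries_le u n :
  u \in square_summable -> Num.sqrt (sqseries u n) <= l2norm u.
Proof.
rewrite inE /= => cu; apply: ler_wsqrtr.
exact: (nondecreasing_cvgn_le (nondecreasing_sqseries u) cu).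
Qed.

Lemma l2norm_bound u (M : R) : 0 <= M ->
  (forall n, Num.sqrt (sqseries u n) <= M) ->
  u \in square_summable /\ l2norm u <= M.
Proof.
move=> M0 uM.
have uM2 n : sqseries u n <= M ^+ 2.
  by rewrite -(sqr_sqrtr (sqseries_ge0 u n)) lerXn2r // nnegrE sqrtr_ge0.
have cu : cvgn (sqseries u).
  apply: nondecreasing_is_cvgn; first exact: nondecreasing_sqseries.
  by exists (M ^+ 2) => _ [n _ <-].
split; first by rewrite inE.
rewrite /l2norm -[leRHS](ger0_norm M0) -sqrtr_sqr; apply: ler_wsqrtr.
by apply: limr_le => //; apply: nearW.
Qed.

Lemma minkowski_step (a b x y : R) : 0 <= a -> 0 <= b -> 0 <= x -> 0 <= y ->
  (a + b) ^+ 2 + (x + y) ^+ 2 <=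
  (Num.sqrt (a ^+ 2 + x ^+ 2) + Num.sqrt (b ^+ 2 + y ^+ 2)) ^+ 2.
Proof.
move=> a0 b0 x0 y0.
rewrite [leRHS]sqrrD !sqr_sqrtr ?addr_ge0 ?sqr_ge0 //.
have : a * b + x * y <=
    Num.sqrt (a ^+ 2 + x ^+ 2) * Num.sqrt (b ^+ 2 + y ^+ 2).
  rewrite -sqrtrM ?addr_ge0 ?sqr_ge0 //.
  rewrite -[leLHS]ger0_norm ?addr_ge0 ?mulr_ge0 // -sqrtr_sqr.
  apply: ler_wsqrtr; rewrite -subr_ge0.
  rewrite (_ : _ - _ = (a * y - b * x) ^+ 2) ?sqr_ge0 //; ring.
set p := Num.sqrt _ * Num.sqrt _ => le_p; rewrite -subr_ge0.
rewrite (_ : _ - _ = (p - (a * b + x * y)) *+ 2); last by ring.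
by rewrite mulrn_wge0 // subr_ge0.
Qed.

Lemma sqseriesD u v n : Num.sqrt (sqseries (u + v) n) <=
  Num.sqrt (sqseries u n) + Num.sqrt (sqseries v n).
Proof.
elim: n => [|n IH]; first by rewrite /sqseries /series /= !big_geq // sqrtr0 addr0.
have S w : sqseries w n.+1 = Num.sqrt (sqseries w n) ^+ 2 + rnorm (w n) ^+ 2.
  by rewrite sqr_sqrtr ?sqseries_ge0 // /sqseries /series /= big_nat_recr.
rewrite !S -[leRHS]ger0_norm ?addr_ge0 ?sqrtr_ge0 // -sqrtr_sqr.
apply: ler_wsqrtr; apply: le_trans (minkowski_step _ _ _ _); rewrite ?sqrtr_ge0 ?rnorm_ge0 //.
by rewrite lerD // lerXn2r // ?nnegrE ?addr_ge0 ?sqrtr_ge0 ?rnorm_ge0 // rnormD.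
Qed.

Lemma l2normD u v : u \in square_summable -> v \in square_summable ->
  u + v \in square_summable /\ l2norm (u + v) <= l2norm u + l2norm v.
Proof.
move=> su sv; apply: l2norm_bound; first by rewrite addr_ge0 // sqrtr_ge0.
by move=> n; rewrite (le_trans (sqseriesD _ _ _)) // lerD // sqseries_le.
Qed.

Lemma l2normZ a u : u \in square_summable ->
  a *: u \in square_summable /\ l2norm (a *: u) = rnorm (a : K^o) * l2norm u.
Proof.
rewrite !inE /= /l2norm => cu.
have E : sqseries (a *: u) = (fun n => rnorm (a : K^o) ^+ 2 * sqseries u n).
  apply/funext => n; rewrite /sqseries /series /= mulr_sumr.
  by apply: eq_bigr => i _; rewrite -exprMn -rnormZ.
have c : sqseries (a *: u) @ \oo --> rnorm (a : K^o) ^+ 2 * limn (sqseries u).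
  by rewrite E; apply: cvgMr.
split; first by apply/cvg_ex; eexists; exact: c.
rewrite (cvg_lim _ c) // sqrtrM ?sqr_ge0 // sqrtr_sqr.
by rewrite ger0_norm ?rnorm_ge0.
Qed.

Lemma square_summable_submod_closed : submod_closed square_summable.
Proof.
split=> [|a u v su sv].
  have [] // := @l2norm_bound 0 0 (lexx _) _ => n.
  rewrite /sqseries /series /= big1 ?sqrtr0 // => i _.
  by rewrite rnorm0 expr0n.
by have [] := l2normD (l2normZ a su).1 sv.
Qed.

HB.instance Definition _ := GRing.isSubmodClosed.Build K (nat -> K^o)
  square_summable square_summable_submod_closed.

Record ell2 := Ell2 {
  ell2_seq :> nat -> K^o;
  ell2_square_summable : ell2_seq \in square_summable }.

HB.instance Definition _ := [isSub for ell2_seq].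
HB.instance Definition _ := [Choice of ell2 by <:].
HB.instance Definition _ := [SubChoice_isSubLmodule of ell2 by <:].

Definition ell2_norm (u : ell2) : K := scalar_of_real (l2norm u).

Lemma ell2_normD u v : ell2_norm (u + v) <= ell2_norm u + ell2_norm v.
Proof.
rewrite /ell2_norm -scalar_of_realD ler_scalar_of_real.
by have [] := l2normD (ell2_square_summable u) (ell2_square_summable v).
Qed.

Lemma ell2_normZ a u : ell2_norm (a *: u) = `|a| * ell2_norm u.
Proof.
rewrite /ell2_norm -(rnormE (a : K^o)) -scalar_of_realM; congr scalar_of_real.
by have [_ <-] := l2normZ a (ell2_square_summable u).
Qed.

Lemma ell2_norm_eq0 u : ell2_norm u = 0 -> u = 0.
Proof.
rewrite /ell2_norm -scalar_of_real0 => /(can_inj scalar_of_realK) u0.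
apply: val_inj; apply/funext => n; apply: rnorm_eq0; apply/eqP.
have := sqseries_le n.+1 (ell2_square_summable u).
rewrite u0 => h.
have : sqseries u n.+1 <= 0.
  by rewrite leNgt -sqrtr_gt0 -leNgt.
rewrite /sqseries /series /= big_nat_recr //= => h2.
rewrite -sqrf_eq0 eq_le sqr_ge0 andbT (le_trans _ h2) // lerDr.
exact: sqseries_ge0.
Qed.

HB.instance Definition _ := Lmodule_isNormed.Build K ell2
  ell2_normD ell2_normZ ell2_norm_eq0.

End L2.

Section Operators.
Context {R : realType} {s : scalars}.
Local Notation K := (scalar_field R s).

Definition bounded_op (X Y : normedModType K) (T : X -> Y) : Prop :=
  exists M : R, forall x, rnorm (T x) <= M * rnorm x.

(* sup and inf below are those of R. The sets are nonempty, and bounded on the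
   relevant side as soon as T and S satisfy bounded_op. *)
Definition opnorm (X Y : normedModType K) (T : X -> Y) : R :=
  sup [set rnorm (T x) | x in [set x | rnorm x <= 1]].

Definition has_rank (X Y : normedModType K) (T : {linear X -> Y}) (k : nat) :=
  exists v : 'I_k -> Y,
    (forall c : 'I_k -> K, \sum_(i < k) c i *: v i = 0 -> forall i, c i = 0) /\
    range T = [set \sum_(i < k) c i *: v i | c in [set: 'I_k -> K]].

Definition approx_number (X Y : normedModType K) (n : nat)
    (S : {linear X -> Y}) : R :=
  inf [set opnorm (S \- L) | L in [set L : {linear X -> Y} |
    bounded_op L /\ exists2 k, (k <= n)%N & has_rank L k]].

Definition hilbert_number (X Y : normedModType K) (n : nat)
    (S : {linear X -> Y}) : R :=
  sup [set r | exists (A : {linear ell2 R s -> X}) (B : {linear Y -> ell2 R s}),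
    [/\ bounded_op A, bounded_op B, opnorm A <= 1, opnorm B <= 1
      & r = approx_number n (B \o (S \o A))]].

(* {dot X for theta}: positive definite, linear in the first argument,
   theta-semilinear in the second, and ip x y = theta (ip y x). *)
Definition is_hilbert (X : normedModType K) : Prop :=
  (forall F : set_system X, ProperFilter F -> cauchy F -> cvg F) /\
  exists ip : {dot X for (@scalar_conj R s)}, forall x, `|x| ^+ 2 = ip x x.

End Operators.

(* Main.v *)
(** Let [V_k] be the supremum of [|det (B S A)|] over contractions [A : K^k -> X]
and [B : Y -> K^k], where [K^k] carries the Euclidean norm.

If [T] is an [(n+1) x (n+1)] matrix [B S A] and [L] has rank at most [n], then [L]
kills some [u <> 0]; choosing unitaries that send the first basis vector to the
directions of [u] and [T u], one sees that [|det T|] is at most [||T - L||] times an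
[n x n] minor of the same form. Hence [V_(n+1) <= h_n V_n].

Conversely, let [M = B S A] nearly attain [V_n]. The operator
[L = S A M^-1 B S] has rank [n], and [f ((S - L) x) det M] is the determinant of the
matrix of [S] bordered by a unit vector [x] and a norming functional [f] of norm one.
Bordering [p A] by [q x], with [p^2 + q^2 = 1], gives a contraction, and likewise for
[B]; the best weights [p^2 = n/(n+1)], [q^2 = 1/(n+1)] cost a factor at most
[sqrt (e (n+1))] on each side, so [a_n V_n <= e (n+1) V_(n+1)]. If [X] is a Hilbert
space, one may take [x] orthogonal to the range of [A], because [S - L] vanishes
there, and no weights are needed on that side; if [Y] is a Hilbert space,
[(S - L) x] lies in the kernel of [B] and the same holds for
[f = <., (S - L) x> / ||(S - L) x||]. *)

From HB Require Import structures.
Require Import Defs.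
From mathcomp Require Import all_boot all_order all_algebra.
From mathcomp Require Import sesquilinear complex ring lra.
From mathcomp Require Import all_classical all_reals all_analysis.

Set Implicit Arguments.
Unset Strict Implicit.
Unset Printing Implicit Defensive.

Import Order.TTheory GRing.Theory Num.Theory.
Import numFieldNormedType.Exports.
Local Open Scope classical_set_scope.
Local Open Scope ring_scope.

(** * Scalars and Euclidean row vectors *)

Section ScalarFacts.
Context {R : realType} {s : scalars}.
Local Notation K := (scalar_field R s).

Definition modulus (a : K) : R := rnorm (a : K^o).

Lemma modulusE (a : K) : scalar_of_real (modulus a) = `|a|.
Proof. exact: (rnormE (a : K^o)). Qed.

Lemma modulus_ge0 (a : K) : 0 <= modulus a.
Proof. exact: rnorm_ge0. Qed.

Lemma modulusM (a b : K) : modulus (a * b) = modulus a * modulus b.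
Proof. exact: (rnormZ a (b : K^o)). Qed.

Lemma modulus0 : modulus (0 : K) = 0.
Proof. exact: rnorm0. Qed.

Lemma scalar_of_real1 : scalar_of_real 1 = 1 :> K.
Proof. by rewrite /scalar_of_real; case: s. Qed.

Lemma scalar_of_realN (x : R) : scalar_of_real (- x) = - scalar_of_real x :> K.
Proof. by rewrite /scalar_of_real; case: s => //; exact: rmorphN. Qed.

Lemma scalar_of_real_inj : injective (scalar_of_real : R -> K).
Proof. exact: can_inj scalar_of_realK. Qed.

Lemma modulus1 : modulus (1 : K) = 1.
Proof. by apply: scalar_of_real_inj; rewrite modulusE normr1 scalar_of_real1. Qed.

Lemma modulusN (a : K) : modulus (- a) = modulus a.
Proof. by apply: scalar_of_real_inj; rewrite !modulusE normrN. Qed.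

Lemma modulus_eq0 (a : K) : (modulus a == 0) = (a == 0).
Proof. by apply/eqP/eqP => [/rnorm_eq0|->]//; exact: modulus0. Qed.

Lemma modulus_gt0 (a : K) : (0 < modulus a) = (a != 0).
Proof. by rewrite lt0r modulus_ge0 andbT modulus_eq0. Qed.

Lemma modulusX (a : K) n : modulus (a ^+ n) = modulus a ^+ n.
Proof. by elim: n => [|n IH]; rewrite ?expr0 ?modulus1 // !exprS modulusM IH. Qed.

Lemma modulusV (a : K) : modulus a^-1 = (modulus a)^-1.
Proof.
have [->|a0] := eqVneq a 0; first by rewrite invr0 modulus0 invr0.
apply: (mulfI (x := modulus a)); first by rewrite modulus_eq0.
by rewrite -modulusM !divff ?modulus1 ?modulus_eq0.
Qed.

Lemma modulus_of_real (x : R) : modulus (scalar_of_real x : K) = `|x|.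
Proof.
wlog x0 : x / 0 <= x => [h|].
  have [/h //|/ltW] := leP 0 x; rewrite -oppr_ge0 => /h.
  by rewrite scalar_of_realN modulusN normrN.
apply: scalar_of_real_inj; rewrite modulusE !ger0_norm //.
by rewrite -scalar_of_real0 ler_scalar_of_real.
Qed.

Lemma scalar_conj_is_zmod_morphism : zmod_morphism (@scalar_conj R s).
Proof. by rewrite /scalar_conj; case: s => // x y; exact: rmorphB. Qed.

Lemma scalar_conj_is_monoid_morphism : monoid_morphism (@scalar_conj R s).
Proof.
rewrite /scalar_conj; case: s => //; split; [exact: rmorph1|exact: rmorphM].
Qed.

HB.instance Definition _ :=
  GRing.isZmodMorphism.Build K K (@scalar_conj R s) scalar_conj_is_zmod_morphism.
HB.instance Definition _ :=
  GRing.isMonoidMorphism.Build K K (@scalar_conj R s) scalar_conj_is_monoid_morphism.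

Lemma scalar_conjK : involutive (@scalar_conj R s).
Proof. by rewrite /scalar_conj; case: s => // x; exact: conjCK. Qed.

Lemma mul_scalar_conj (a : K) : a * scalar_conj a = scalar_of_real (modulus a ^+ 2).
Proof.
rewrite expr2 scalar_of_realM modulusE /scalar_conj.
move: a; case: s => a; last by rewrite -normCK expr2.
by rewrite -expr2 real_normK ?num_real.
Qed.

Lemma scalar_conj_of_real (x : R) :
  scalar_conj (scalar_of_real x) = scalar_of_real x :> K.
Proof.
by rewrite /scalar_conj /scalar_of_real; case: s => //; exact: conjc_real.
Qed.

(** The squared Euclidean norm. Vectors are rows, so matrices act on the right, and bounds are kept
    squared to avoid roots. *)
Definition sqn k (u : 'rV[K]_k) : R := \sum_j modulus (u ord0 j) ^+ 2.

Definition adjmx m n (A : 'M[K]_(m, n)) : 'M[K]_(n, m) := (map_mx scalar_conj A)^T.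

Lemma adjmxM m n p (A : 'M[K]_(m, n)) (B : 'M[K]_(n, p)) :
  adjmx (A *m B) = adjmx B *m adjmx A.
Proof. by rewrite /adjmx map_mxM trmx_mul. Qed.

Lemma sqnE k (u : 'rV[K]_k) : u *m adjmx u = (scalar_of_real (sqn u))%:M.
Proof.
rewrite [LHS]mx11_scalar mxE /sqn; congr (_ %:M).
rewrite (big_morph _ (@scalar_of_realD R s) (@scalar_of_real0 R s)).
by apply: eq_bigr => j _; rewrite !mxE mul_scalar_conj.
Qed.

Lemma sqn_ge0 k (u : 'rV[K]_k) : 0 <= sqn u.
Proof. by apply: sumr_ge0 => j _; rewrite sqr_ge0. Qed.

Lemma sqn0 k : sqn (0 : 'rV[K]_k) = 0.
Proof. by rewrite /sqn big1 // => j _; rewrite mxE modulus0 expr0n. Qed.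

Lemma sqn_eq0 k (u : 'rV[K]_k) : (sqn u == 0) = (u == 0).
Proof.
apply/eqP/eqP => [u0|->]; last exact: sqn0.
apply/rowP => j; rewrite mxE.
have /eqP : modulus (u ord0 j) ^+ 2 = 0.
  by apply: psumr_eq0P u0 _ _ => // i _; rewrite sqr_ge0.
by rewrite sqrf_eq0 modulus_eq0 => /eqP.
Qed.

Lemma sqnZ k a (u : 'rV[K]_k) : sqn (a *: u) = modulus a ^+ 2 * sqn u.
Proof.
by rewrite /sqn mulr_sumr; apply: eq_bigr => j _; rewrite mxE modulusM exprMn.
Qed.

Lemma sqn_row_mx k l (u : 'rV[K]_k) (v : 'rV[K]_l) :
  sqn (row_mx u v) = sqn u + sqn v.
Proof.
rewrite /sqn big_split_ord /=; congr (_ + _); apply: eq_bigr => j _.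
  by rewrite row_mxEl.
by rewrite row_mxEr.
Qed.

Lemma sqn_scalar (a : K) : sqn a%:M = modulus a ^+ 2.
Proof. by rewrite /sqn big_ord1 mxE eqxx mulr1n. Qed.

Lemma householder n (u : 'rV[K]_(1 + n)) : u != 0 ->
  exists (c : K) (U : 'M[K]_(1 + n)), [/\ row_mx 1%:M 0 *m U = c *: u,
    U *m U = 1%:M & forall w, sqn (w *m U) = sqn w].
Proof.
(* The phase [z] makes the first entry [t] of the unit vector [c *: u] nonpositive,
   so that [1 - t] is invertible and the reflection exchanging it with [e] exists
   even over the complex numbers. *)
move=> u0.
have ru : 0 < sqn u by rewrite lt0r sqn_eq0 u0 sqn_ge0.
pose a := u ord0 ord0.
pose z : K := if a == 0 then 1 else - (`|a| / a).
have za : z * a = - `|a|.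
  rewrite /z; case: eqVneq => [->|a0]; first by rewrite normr0 mulr0 oppr0.
  by rewrite mulNr divfK.
have z1 : modulus z = 1.
  rewrite /z; case: eqVneq => [_|a0]; first exact: modulus1.
  by rewrite modulusN modulusM modulusV -modulusE modulus_of_real
    ger0_norm ?modulus_ge0 // divff // modulus_eq0.
pose r := Num.sqrt (sqn u); have r0 : 0 < r by rewrite sqrtr_gt0.
pose c := z * scalar_of_real r^-1.
have c2 : sqn (c *: u) = 1.
  rewrite sqnZ /c modulusM z1 mul1r modulus_of_real ger0_norm ?invr_ge0 ?ltW //.
  by rewrite exprVn sqr_sqrtr ?ltW // mulVf // gt_eqF.
pose e : 'rV[K]_(1 + n) := row_mx 1%:M 0.
pose t : R := - (modulus a * r^-1).
have t0 : t <= 0 by rewrite oppr_le0 mulr_ge0 ?modulus_ge0 // invr_ge0 ltW.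
have ct : c * a = scalar_of_real t.
  by rewrite /c mulrAC za /t scalar_of_realN scalar_of_realM modulusE mulNr.
pose w : 'rV[K]_(1 + n) := c *: u - e.
have e0 : adjmx e = col_mx 1%:M 0.
  by rewrite /adjmx map_row_mx tr_row_mx map_mx1 trmx1 map_mx0 trmx0.
have ue : (c *: u) *m adjmx e = (scalar_of_real t)%:M.
  rewrite -[u]hsubmxK e0 -scalemxAl mul_row_col mulmx1 mulmx0 addr0.
  rewrite [lsubmx u]mx11_scalar scale_scalar_mx -ct mxE; congr ((_ * u _ _)%:M).
  exact: val_inj.
have eu : e *m adjmx (c *: u) = (scalar_of_real t)%:M.
  have := congr1 (@adjmx _ _) ue; rewrite adjmxM.
  rewrite [X in X *m _](_ : _ = e).
    by rewrite /adjmx => ->; rewrite map_scalar_mx tr_scalar_mx /= scalar_conj_of_real.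
  by apply/matrixP => i j; rewrite !mxE scalar_conjK.
have ee : e *m adjmx e = 1%:M by rewrite e0 mul_row_col mulmx0 addr0 mulmx1.
have uu : (c *: u) *m adjmx (c *: u) = 1%:M by rewrite sqnE c2 scalar_of_real1.
have adjB (x y : 'rV[K]_(1 + n)) : adjmx (x - y) = adjmx x - adjmx y.
  by apply/matrixP => i j; rewrite !mxE rmorphB.
have d0 : 1 - t != 0 by rewrite gt_eqF // subr_gt0 (le_lt_trans t0).
pose d : K := scalar_of_real (1 - t)^-1.
have dd : d * scalar_of_real (1 - t) = 1.
  by rewrite /d -scalar_of_realM mulVf // scalar_of_real1.
have t1 : scalar_of_real (1 - t) = 1 - scalar_of_real t :> K.
  by rewrite scalar_of_realD scalar_of_realN scalar_of_real1.
have ew : e *m adjmx w = (- scalar_of_real (1 - t))%:M.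
  by rewrite adjB mulmxBr eu ee -raddfB /= t1 opprB.
have ww : w *m adjmx w = (scalar_of_real (1 - t) *+ 2)%:M.
  rewrite {1}/w mulmxBl ew adjB mulmxBr uu ue -!raddfB /= t1; congr (_ %:M); ring.
(* Since [w *m adjmx w] is [2 (1 - t)], [1 - d P] with [d = 1 / (1 - t)] is the reflection in the
   hyperplane orthogonal to [w]; involutive and self-adjoint, it is isometric. *)
pose P := adjmx w *m w.
pose U := 1%:M - d *: P.
have PP : P *m P = (scalar_of_real (1 - t) *+ 2) *: P.
  by rewrite /P mulmxA -(mulmxA _ w) ww mul_mx_scalar -scalemxAl.
have UU : U *m U = 1%:M.
  rewrite /U mulmxBl mul1mx mulmxBr mulmx1 -scalemxAl -scalemxAr PP !scalerA.
  have -> : d * d * (scalar_of_real (1 - t) *+ 2) = d *+ 2.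
    by rewrite -mulrA mulrnAr dd mulrnAr mulr1.
  by rewrite mulr2n scalerDl opprB addrK addrNK.
have aU : adjmx U = U.
  rewrite /adjmx /U map_mxB map_mx1 map_mxZ linearB /= linearZ /= trmx1.
  rewrite /d scalar_conj_of_real; congr (_ - _ *: _).
  rewrite [LHS]adjmxM; congr (_ *m _).
  by apply/matrixP => i j; rewrite !mxE scalar_conjK.
exists c, U; split => //.
  rewrite /U mulmxBr mulmx1 -scalemxAr mulmxA ew mul_scalar_mx scalerA.
  by rewrite mulrN dd scaleN1r opprK /w addrC subrK.
move=> v; have := sqnE (v *m U).
rewrite adjmxM aU mulmxA -(mulmxA v) UU mulmx1 sqnE => /matrixP/(_ ord0 ord0).
by rewrite !mxE eqxx !mulr1n => /scalar_of_real_inj.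
Qed.

(** Reflections send the first basis vector to the directions of [u] and [u *m M]. In these bases
    [M] is block lower triangular: its corner has modulus [||u M|| / ||u||], at most [d], and the
    other diagonal block is the minor. *)
Lemma det_le_minor n (M : 'M[K]_(1 + n)) (u : 'rV[K]_(1 + n)) (d : R) :
  0 <= d -> u != 0 -> sqn (u *m M) <= d ^+ 2 * sqn u ->
  exists (V : 'M[K]_(n, 1 + n)) (W : 'M[K]_(1 + n, n)),
  [/\ forall w, sqn (w *m V) = sqn w, forall w, sqn (w *m W) <= sqn w
    & modulus (\det M) <= d * modulus (\det (V *m M *m W))].
Proof.
move=> d0 u0 uM.
have su : 0 < sqn u by rewrite lt0r sqn_eq0 u0 sqn_ge0.
have emb (w : 'rV[K]_n) : w *m row_mx 0 1%:M = row_mx (0 : 'rV[K]_1) w.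
  by rewrite mul_mx_row mulmx0 mulmx1.
have prj (w : 'rV[K]_(1 + n)) : sqn (w *m col_mx 0 1%:M) <= sqn w.
  rewrite -[w]hsubmxK mul_row_col mulmx0 mulmx1 add0r sqn_row_mx.
  by rewrite lerDr sqn_ge0.
(* If [u *m M = 0] there is no direction to reflect to, but then [\det M = 0] and a coordinate
   embedding and projection will do. *)
have [v0|v0] := eqVneq (u *m M) 0.
  exists (row_mx 0 1%:M), (col_mx 0 1%:M); split => //.
    by move=> w; rewrite emb sqn_row_mx sqn0 add0r.
  have -> : \det M = 0; last by rewrite modulus0 mulr_ge0 ?modulus_ge0.
  by apply/eqP/det0P; exists u.
have [c [U [eU UU sU]]] := householder u0.
have [c' [U' [eU' UU' sU']]] := householder v0.
have sv : 0 < sqn (u *m M) by rewrite lt0r sqn_eq0 v0 sqn_ge0.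
have unitary m (A : 'M[K]_m) : A *m A = 1%:M -> modulus (\det A) = 1.
  move=> AA; apply/eqP; rewrite -(@eqrXn2 _ 2) ?modulus_ge0 // expr1n.
  by rewrite expr2 -modulusM -det_mulmx AA det1 modulus1.
have se : sqn (row_mx (1%:M : 'M[K]_1) 0 : 'rV[K]_(1 + n)) = 1.
  by rewrite sqn_row_mx sqn0 sqn_scalar modulus1 expr1n addr0.
have c0 : modulus c ^+ 2 * sqn u = 1 by rewrite -sqnZ -eU sU.
have c'0 : modulus c' ^+ 2 * sqn (u *m M) = 1 by rewrite -sqnZ -eU' sU'.
have c'n : c' != 0.
  by apply: contra_eq_neq c'0 => ->; rewrite modulus0 expr0n mul0r eq_sym oner_eq0.
pose N := U *m M *m U'.
have eN : row_mx 1%:M 0 *m N = (c / c') *: row_mx 1%:M 0.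
  rewrite [in RHS](_ : row_mx _ _ = c' *: (u *m M *m U')); last first.
    by rewrite scalemxAl -eU' -mulmxA UU' mulmx1.
  by rewrite scalerA divfK // /N !mulmxA eU !scalemxAl.
exists (row_mx 0 1%:M *m U), (U' *m col_mx 0 1%:M); split.
- by move=> w; rewrite mulmxA sU emb sqn_row_mx sqn0 add0r.
- by move=> w; rewrite mulmxA (le_trans (prj _)) // sU'.
have -> : row_mx 0 1%:M *m U *m M *m (U' *m col_mx 0 1%:M) = drsubmx N.
  transitivity (row_mx 0 1%:M *m N *m col_mx 0 1%:M); first by rewrite /N !mulmxA.
  rewrite -[N in LHS]submxK.
  by rewrite mul_row_block !mul0mx !add0r !mul1mx mul_row_col mulmx0 add0r mulmx1.
have : modulus (\det N) = modulus (\det M).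
  by rewrite /N !det_mulmx !modulusM (unitary _ _ UU) (unitary _ _ UU') mul1r mulr1.
move=> <-; move: eN; rewrite -[N in LHS]submxK mul_row_block !mul1mx !mul0mx !addr0.
rewrite scale_row_mx scaler0 => /eq_row_mx[Nul Nur].
rewrite -[N in X in X <= _]submxK Nur Nul det_lblock modulusM ler_wpM2r ?modulus_ge0 //.
rewrite scalemx1 det_scalar1 -[leRHS]ger0_norm // -[leLHS]ger0_norm ?modulus_ge0 //.
rewrite -ler_sqr ?nnegrE ?normr_ge0 //.
rewrite !ger0_norm ?modulus_ge0 // modulusM modulusV exprMn exprVn.
have -> : modulus c ^+ 2 = (sqn u)^-1.
  by apply: (mulIf (lt0r_neq0 su)); rewrite c0 mulVf // lt0r_neq0.
have -> : modulus c' ^+ 2 = (sqn (u *m M))^-1.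
  by apply: (mulIf (lt0r_neq0 sv)); rewrite c'0 mulVf // lt0r_neq0.
by rewrite invrK mulrC ler_pdivrMr.
Qed.

End ScalarFacts.

(** * Operator norms, approximation numbers and maximal determinants *)

Section OperatorNorms.
Context {R : realType} {s : scalars}.
Local Notation K := (scalar_field R s).
Context {X Y : normedModType K}.

Lemma rnormN (V : normedModType K) (x : V) : rnorm (- x) = rnorm x.
Proof. by apply: (scalar_of_real_inj (s := s)); rewrite !rnormE normrN. Qed.

Lemma rnormB (V : normedModType K) (x y : V) : rnorm (x - y) <= rnorm x + rnorm y.
Proof. by rewrite -(rnormN y) rnormD. Qed.

Lemma bounded_opP (T : X -> Y) : bounded_op T ->
  exists2 C : R, 0 <= C & forall x, rnorm (T x) <= C * rnorm x.
Proof.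
move=> [C CT]; exists (Num.max C 0); first by rewrite le_max lexx orbT.
by move=> x; rewrite (le_trans (CT x)) // ler_wpM2r ?rnorm_ge0 // le_max lexx.
Qed.

Lemma opnorm_ge0 (T : {linear X -> Y}) : 0 <= opnorm T.
Proof.
rewrite /opnorm; set D := (X in sup X).
have D0 : D 0 by exists 0; rewrite /= ?linear0 rnorm0 ?ler01.
have [sD|/sup_out -> //] := pselect (has_sup D).
by apply: ub_le_sup => //; case: sD.
Qed.

Lemma opnorm_le (T : {linear X -> Y}) (C : R) : 0 <= C ->
  (forall x, rnorm (T x) <= C * rnorm x) -> opnorm T <= C.
Proof.
move=> C0 CT; apply: ge_sup; first by exists (rnorm (T 0)), 0; rewrite //= rnorm0 ler01.
move=> _ [x /= x1 <-]; rewrite (le_trans (CT x)) //.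
by rewrite -[leRHS]mulr1 ler_wpM2l.
Qed.

Lemma le_opnorm (T : {linear X -> Y}) x : bounded_op T ->
  rnorm (T x) <= opnorm T * rnorm x.
Proof.
move=> /bounded_opP[C C0 CT].
have [->|x0] := eqVneq x 0; first by rewrite linear0 !rnorm0 mulr0.
have rx : 0 < rnorm x.
  by rewrite lt0r rnorm_ge0 andbT; apply: contra_neq x0; exact: rnorm_eq0.
pose y := scalar_of_real (rnorm x)^-1 *: x.
have ry (V : normedModType K) (z : V) :
    rnorm (scalar_of_real (rnorm x)^-1 *: z) = (rnorm x)^-1 * rnorm z.
  by rewrite rnormZ -/(modulus _) modulus_of_real ger0_norm // invr_ge0 ltW.
have : rnorm (T y) <= opnorm T.
  apply: ub_le_sup; last by exists y; rewrite //= ry mulVf // gt_eqF.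
  exists C => _ [z /= z1 <-]; rewrite (le_trans (CT z)) //.
  by rewrite -[leRHS]mulr1 ler_wpM2l.
by rewrite /y linearZ ry mulrC ler_pdivrMr.
Qed.

Lemma bounded_opB (T L : X -> Y) : bounded_op T -> bounded_op L ->
  bounded_op (T \- L).
Proof.
move=> [C CT] [D DL]; exists (C + D) => x.
by rewrite /= (le_trans (rnormB _ _)) // mulrDl lerD.
Qed.

Lemma bounded_op0 : bounded_op (\0 : {linear X -> Y}).
Proof. by exists 0 => x; rewrite rnorm0 mul0r. Qed.

Lemma has_rank0 : has_rank (\0 : {linear X -> Y}) 0.
Proof.
exists (fun=> 0); split=> [c _ [] //|].
apply/seteqP; split=> [_ [x _ <-]|_ [c _ <-]] /=.
  by exists (fun=> 0) => //; rewrite big_ord0.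
by exists 0 => //; rewrite big_ord0.
Qed.

Lemma approx_set_nonempty n (T : {linear X -> Y}) :
  [set opnorm (T \- L) | L in [set L : {linear X -> Y} |
    bounded_op L /\ exists2 k, (k <= n)%N & has_rank L k]] !=set0.
Proof.
exists (opnorm (T \- \0)), \0 => //=; split; first exact: bounded_op0.
by exists 0%N => //; exact: has_rank0.
Qed.

Lemma approx_set_lbound n (T : {linear X -> Y}) :
  lbound [set opnorm (T \- L) | L in [set L : {linear X -> Y} |
    bounded_op L /\ exists2 k, (k <= n)%N & has_rank L k]] 0.
Proof. by move=> _ [L _ <-]; exact: opnorm_ge0. Qed.

Lemma approx_number_ge0 n (T : {linear X -> Y}) : 0 <= approx_number n T.
Proof. by apply: lb_le_inf (approx_set_nonempty n T) (@approx_set_lbound n T). Qed.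

Lemma approx_number_le n k (T L : {linear X -> Y}) :
  bounded_op L -> (k <= n)%N -> has_rank L k ->
  approx_number n T <= opnorm (T \- L).
Proof.
move=> bL kn rL; apply: ge_inf; first by exists 0; exact: approx_set_lbound.
by exists L => //; split=> //; exists k.
Qed.

Lemma approx_number_lt n (T : {linear X -> Y}) (d : R) : approx_number n T < d ->
  exists k (L : {linear X -> Y}), [/\ bounded_op L, (k <= n)%N, has_rank L k
    & opnorm (T \- L) < d].
Proof.
move=> /(inf_lt (approx_set_nonempty n T))[_ [L [bL [k kn rL]] <-] Ld].
by exists k, L.
Qed.

Lemma approx_number_le_bound n (T : {linear X -> Y}) (C : R) : 0 <= C ->
  (forall x, rnorm (T x) <= C * rnorm x) -> approx_number n T <= C.
Proof.
move=> C0 CT.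
apply: le_trans (approx_number_le T bounded_op0 (leq0n n) has_rank0) _.
by apply: opnorm_le => // x; rewrite /= subr0.
Qed.

End OperatorNorms.

Section VolumeNumbers.
Context {R : realType} {s : scalars}.
Local Notation K := (scalar_field R s).
Context {X Y : normedModType K}.

Definition contraction_from k (A : 'rV[K]_k -> X) :=
  forall u, rnorm (A u) ^+ 2 <= sqn u.

Definition contraction_to k (B : Y -> 'rV[K]_k) :=
  forall y, sqn (B y) <= rnorm y ^+ 2.

Definition compression (S : {linear X -> Y}) k (A : {linear 'rV[K]_k -> X})
    (B : {linear Y -> 'rV[K]_k}) : 'M[K]_k := lin1_mx (B \o (S \o A)).

Definition volumes (S : {linear X -> Y}) k : set R :=
  [set r | exists (A : {linear 'rV[K]_k -> X}) (B : {linear Y -> 'rV[K]_k}),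
    [/\ contraction_from A, contraction_to B
      & r = modulus (\det (compression S A B))]].

Definition volume S k : R := sup (volumes S k).

Variable S : {linear X -> Y}.
Hypothesis hS : bounded_op S.

Lemma mul_compression k (A : {linear 'rV[K]_k -> X})
    (B : {linear Y -> 'rV[K]_k}) (u : 'rV[K]_k) :
  u *m compression S A B = B (S (A u)).
Proof. by rewrite /compression mul_rV_lin1. Qed.

(** In [det_le_minor] for the compression, [V] is absorbed into [A] and [W] into [B]; both stay
    contractions, as [V] is isometric and [W] contractive. *)
Lemma det_compression_le k (A : {linear 'rV[K]_(1 + k) -> X})
    (B : {linear Y -> 'rV[K]_(1 + k)}) (u : 'rV[K]_(1 + k)) (d : R) :
  contraction_from A -> contraction_to B -> 0 <= d -> u != 0 ->
  sqn (B (S (A u))) <= d ^+ 2 * sqn u ->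
  exists (A' : {linear 'rV[K]_k -> X}) (B' : {linear Y -> 'rV[K]_k}),
    [/\ contraction_from A', contraction_to B' & modulus (\det (compression S A B))
      <= d * modulus (\det (compression S A' B'))].
Proof.
move=> cA cB d0 u0; rewrite -mul_compression => /(det_le_minor d0 u0)[V [W [iV cW dVW]]].
exists (A \o mulmxr V), (mulmxr W \o B); split.
- by move=> w; rewrite /= (le_trans (cA _)) // iV.
- by move=> y; rewrite /= (le_trans (cW _)).
rewrite (le_trans dVW) //; have -> // : V *m compression S A B *m W =
  compression S (A \o mulmxr V) (mulmxr W \o B).
apply/row_matrixP => i; rewrite [LHS]rowE [RHS]rowE mul_compression /=.
by rewrite !mulmxA mul_compression.
Qed.

(** Removing one dimension at a time, with [d] a norm bound [C] of [S], bounds the determinants by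
    [C ^+ k]. *)
Lemma volumes_has_ubound k : has_ubound (volumes S k).
Proof.
have [C C0 CS] := bounded_opP hS.
exists (C ^+ k) => _ [A [B [cA cB ->]]].
elim: k A B cA cB => [|k IH] A B cA cB; first by rewrite det_mx00 modulus1 expr0.
pose u : 'rV[K]_(1 + k) := row_mx 1%:M 0.
have su : sqn u = 1 by rewrite sqn_row_mx sqn0 sqn_scalar modulus1 expr1n addr0.
have u0 : u != 0 by rewrite -sqn_eq0 su oner_eq0.
have [|A' [B' [cA' cB']]] := det_compression_le cA cB C0 u0.
  rewrite (le_trans (cB _)) // (le_trans (y := (C * rnorm (A u)) ^+ 2)) //.
    by rewrite lerXn2r ?nnegrE ?mulr_ge0 ?rnorm_ge0.
  by rewrite exprMn ler_wpM2l ?sqr_ge0.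
by move=> /le_trans; apply; rewrite exprS ler_wpM2l // IH.
Qed.

Lemma le_volume k (A : {linear 'rV[K]_k -> X}) (B : {linear Y -> 'rV[K]_k}) :
  contraction_from A -> contraction_to B ->
  modulus (\det (@compression S k A B)) <= volume S k.
Proof. by move=> cA cB; apply: ub_le_sup; [exact: volumes_has_ubound|exists A, B]. Qed.

Lemma volumes_nonempty k : volumes S k !=set0.
Proof.
exists (modulus (\det (@compression S k \0 \0))), \0, \0; split=> //.
  by move=> u; rewrite rnorm0 expr0n sqn_ge0.
by move=> y; rewrite sqn0 sqr_ge0.
Qed.

Lemma volume_ge0 k : 0 <= volume S k.
Proof.
have [r vr] := volumes_nonempty k.
apply: le_trans (ub_le_sup (@volumes_has_ubound k) vr).
by case: vr => A [B [_ _ ->]]; exact: modulus_ge0.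
Qed.

Lemma volume0 : volume S 0 = 1.
Proof.
rewrite /volume (_ : volumes S 0 = [set 1]) ?sup1 //.
apply/seteqP; split=> [_ [A [B [_ _ ->]]]|_ ->] /=; first by rewrite det_mx00 modulus1.
have [r vr] := volumes_nonempty 0; move: (vr) => [A [B [_ _ E]]].
by move: E vr; rewrite det_mx00 modulus1 => ->.
Qed.

End VolumeNumbers.

(** * Hilbert numbers and ratios of maximal determinants *)

Section Ell2Embedding.
Context {R : realType} {s : scalars}.
Local Notation K := (scalar_field R s).

Definition pad_seq k (u : 'rV[K]_k) (i : nat) : K^o :=
  if insub i is Some j then u ord0 j else 0.

Lemma pad_seqE k (u : 'rV[K]_k) (j : 'I_k) : pad_seq u j = u ord0 j.
Proof. by rewrite /pad_seq valK. Qed.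

Lemma sqseries_size (v : nat -> K^o) k :
  sqseries v k = sqn (\row_(j < k) (v j : K)).
Proof. by rewrite /sqseries /series /= big_mkord; apply: eq_bigr => j _; rewrite mxE. Qed.

Lemma pad_row k (u : 'rV[K]_k) : \row_(j < k) (pad_seq u j : K) = u.
Proof. by apply/rowP => j; rewrite mxE pad_seqE. Qed.

Lemma sqseries_pad k (u : 'rV[K]_k) n : sqseries (pad_seq u) n <= sqn u.
Proof.
apply: (@le_trans _ _ (sqseries (pad_seq u) (maxn n k))).
  by apply: nondecreasing_sqseries; rewrite leq_maxl.
suff -> : sqseries (pad_seq u) (maxn n k) = sqseries (pad_seq u) k.
  by rewrite sqseries_size pad_row.
rewrite /sqseries /series /= (big_cat_nat (n := k)) ?leq_maxr //=.
rewrite [X in _ + X]big_nat [X in _ + X]big1 ?addr0 // => i /andP[ki _].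
by rewrite /pad_seq insubF ?rnorm0 ?expr0n // ltnNge ki.
Qed.

Lemma pad_seq_square_summable k (u : 'rV[K]_k) : pad_seq u \in @square_summable R s.
Proof.
have [] // := @l2norm_bound R s (pad_seq u) (Num.sqrt (sqn u)).
by move=> n; apply: ler_wsqrtr; exact: sqseries_pad.
Qed.

Definition pad k (u : 'rV[K]_k) : ell2 R s := Ell2 (pad_seq_square_summable u).

Lemma pad_is_linear k : linear (@pad k).
Proof.
move=> a u v; apply: val_inj; apply/funext => i.
rewrite GRing.valD GRing.valZ /= /pad_seq.
rewrite -[RHS]/(a *: pad_seq u i + pad_seq v i) /pad_seq.
by case: insubP => [j _ _|_]; rewrite ?mxE // scaler0 addr0.
Qed.
HB.instance Definition _ k :=
  GRing.isLinear.Build K 'rV[K]_k (ell2 R s) *:%R (@pad k) (@pad_is_linear k).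

Definition trunc k (v : ell2 R s) : 'rV[K]_k := \row_(j < k) (v j : K).

Lemma trunc_is_linear k : linear (@trunc k).
Proof.
move=> a u v; apply/rowP => j; rewrite !mxE.
by rewrite -[LHS]/(val (a *: u + v) j) GRing.valD GRing.valZ.
Qed.
HB.instance Definition _ k :=
  GRing.isLinear.Build K (ell2 R s) 'rV[K]_k *:%R (@trunc k) (@trunc_is_linear k).

Lemma padK k : cancel (@pad k) (@trunc k).
Proof. by move=> u; apply/rowP => j; rewrite mxE; exact: pad_seqE. Qed.

Lemma rnorm_ell2 (v : ell2 R s) : rnorm v = l2norm v.
Proof. exact: scalar_of_realK. Qed.

Lemma sqn_trunc k (v : ell2 R s) : sqn (trunc k v) <= rnorm v ^+ 2.
Proof.
rewrite -sqseries_size rnorm_ell2.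
rewrite -[leLHS]sqr_sqrtr ?sqseries_ge0 // lerXn2r ?nnegrE ?sqrtr_ge0 //.
exact/sqseries_le/ell2_square_summable.
Qed.

Lemma rnorm_pad k (u : 'rV[K]_k) : rnorm (pad u) ^+ 2 = sqn u.
Proof.
apply/eqP; rewrite eq_le -[X in sqn X <= _]padK sqn_trunc andbT.
rewrite -[leRHS]sqr_sqrtr ?sqn_ge0 // lerXn2r ?nnegrE ?sqrtr_ge0 ?rnorm_ge0 //.
rewrite rnorm_ell2.
have [] // := @l2norm_bound R s (pad_seq u) (Num.sqrt (sqn u)).
by move=> n; apply: ler_wsqrtr; exact: sqseries_pad.
Qed.

End Ell2Embedding.

Section HilbertNumbers.
Context {R : realType} {s : scalars}.
Local Notation K := (scalar_field R s).
Context {X Y : normedModType K}.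
Variable S : {linear X -> Y}.
Hypothesis hS : bounded_op S.

(** Approximation by zero gives [a_n (B S A) <= ||B S A||], which is at most any norm bound of [S].
    Hence the supremum defining the Hilbert number is genuine. *)
Lemma hilbert_set_has_ubound n : has_ubound [set r |
  exists (A : {linear ell2 R s -> X}) (B : {linear Y -> ell2 R s}),
    [/\ bounded_op A, bounded_op B, opnorm A <= 1, opnorm B <= 1
      & r = approx_number n (B \o (S \o A))]].
Proof.
have [C C0 CS] := bounded_opP hS.
exists C => _ [A [B [bA bB A1 B1 ->]]]; apply: approx_number_le_bound => // x /=.
have le1 (V W : normedModType K) (T : {linear V -> W}) z :
    bounded_op T -> opnorm T <= 1 -> rnorm (T z) <= rnorm z.
  move=> bT T1; rewrite (le_trans (le_opnorm _ bT)) //.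
  by rewrite -[leRHS]mul1r ler_wpM2r ?rnorm_ge0.
rewrite (le_trans (le1 _ _ _ _ bB B1)) // (le_trans (CS _)) // ler_wpM2l //.
exact: le1.
Qed.

Lemma hilbert_number_ge0 n : 0 <= hilbert_number n S.
Proof.
apply: (@le_trans _ _ (approx_number n
    ((\0 : {linear Y -> ell2 R s}) \o (S \o (\0 : {linear ell2 R s -> X}))))).
  exact: approx_number_ge0.
apply: ub_le_sup; first exact: hilbert_set_has_ubound.
exists \0, \0; split=> //; [exact: bounded_op0|exact: bounded_op0| |];
  by apply: opnorm_le => // x; rewrite rnorm0 mul1r rnorm_ge0.
Qed.

(** Expanding the images of the [n] basis vectors in the basis [v] of the range gives an [n x k]
    matrix; as [k < n], its rows are dependent, and a dependency is the required [u]. *)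
Lemma finite_rank_kernel (Z W : normedModType K) n k (L : {linear Z -> W})
    (f : {linear 'rV[K]_n -> Z}) : has_rank L k -> (k < n)%N ->
  exists2 u : 'rV[K]_n, u != 0 & L (f u) = 0.
Proof.
move=> [v [_ rL]] kn.
have /choice[c cL] (j : 'I_n) : exists c : 'I_k -> K,
    L (f (delta_mx ord0 j)) = \sum_(i < k) c i *: v i.
  have : range L (L (f (delta_mx ord0 j))) by exists (f (delta_mx ord0 j)).
  by rewrite rL => -[c _ <-]; exists c.
pose C := \matrix_(j < n, i < k) c j i.
have : kermx C != 0.
  rewrite kermx_eq0 /row_free; apply: contraTneq kn => <-.
  by rewrite -leqNgt rank_leq_col.
case/rowV0Pn => u /sub_kermxP uC u0; exists u => //.
rewrite [u]row_sum_delta !linear_sum /=.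
under eq_bigr do rewrite !linearZ_LR /= cL scaler_sumr.
rewrite exchange_big big1 //= => i _.
under eq_bigr do rewrite scalerA.
rewrite -scaler_suml; have /rowP/(_ i) := uC; rewrite !mxE => uCi.
rewrite (eq_bigr (fun j => u ord0 j * C j i)) ?uCi ?scale0r // => j _.
by rewrite mxE.
Qed.

(** Truncation and padding turn [A] and [B] into operators from and to [ell2]. An approximant of
    rank at most [n] kills some nonzero padded row of length [n+1]; there [B S A] is as small as the
    approximation error, and one dimension can be removed at that cost. *)
Lemma det_compression_le_hilbert n (A : {linear 'rV[K]_n.+1 -> X})
    (B : {linear Y -> 'rV[K]_n.+1}) :
  contraction_from A -> contraction_to B ->
  modulus (\det (compression S A B)) <= hilbert_number n S * volume S n.
Proof.
move=> cA cB; pose A2 : {linear ell2 R s -> X} := A \o @trunc R s n.+1.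
pose B2 : {linear Y -> ell2 R s} := @pad R s n.+1 \o B.
have nA x : rnorm (A2 x) <= 1 * rnorm x.
  rewrite mul1r -ler_sqr ?nnegrE ?rnorm_ge0 // (le_trans (cA _)) //.
  exact: sqn_trunc.
have nB y : rnorm (B2 y) <= 1 * rnorm y.
  by rewrite mul1r -ler_sqr ?nnegrE ?rnorm_ge0 // rnorm_pad.
have hT : approx_number n (B2 \o (S \o A2)) <= hilbert_number n S.
  apply: ub_le_sup; first exact: hilbert_set_has_ubound.
  by exists A2, B2; split=> //; [exists 1|exists 1|exact: opnorm_le|exact: opnorm_le].
have bT : bounded_op (B2 \o (S \o A2)).
  have [C C0 CS] := bounded_opP hS; exists C => x /=.
  rewrite (le_trans (nB _)) // mul1r (le_trans (CS _)) // ler_wpM2l //.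
  by rewrite (le_trans (nA _)) ?mul1r.
apply/ler_addgt0Pr => e e0.
have V0 := volume_ge0 hS n.
(* With this excess over the Hilbert number, [d * volume S n] exceeds the target by at most [e]; the
   [+ 1] keeps the denominator positive. *)
pose d := hilbert_number n S + e / (volume S n + 1).
have hd : hilbert_number n S < d by rewrite ltrDl divr_gt0 // ltr_wpDl.
have d0 : 0 <= d := le_trans (hilbert_number_ge0 n) (ltW hd).
have [k [L [bL kn rL Ld]]] := approx_number_lt (le_lt_trans hT hd).
have [u u0 Lu] := finite_rank_kernel (@pad R s n.+1) rL kn.
have := @det_compression_le _ _ _ _ S n A B u d cA cB d0 u0; case.
  have -> : B (S (A u)) = trunc n.+1 ((B2 \o (S \o A2) \- L) (pad u)).
    by rewrite /= Lu subr0 /= !padK.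
  rewrite (le_trans (sqn_trunc _ _)) // -rnorm_pad -exprMn.
  rewrite lerXn2r ?nnegrE ?mulr_ge0 ?rnorm_ge0 //.
  have bTL := bounded_opB bT bL.
  rewrite (le_trans (le_opnorm _ bTL)) // ler_wpM2r ?rnorm_ge0 // ltW //.
move=> A' [B' [cA' cB' /le_trans]]; apply.
rewrite (le_trans (y := d * volume S n)) ?ler_wpM2l ?le_volume //.
rewrite mulrDl lerD2l mulrAC ler_pdivrMr ?ltr_wpDl // ler_pM2l //.
by rewrite lerDl ler01.
Qed.

Lemma volumeS_le n : volume S n.+1 <= hilbert_number n S * volume S n.
Proof.
apply: ge_sup; first exact: volumes_nonempty.
by move=> _ [A [B [cA cB ->]]]; exact: det_compression_le_hilbert.
Qed.

End HilbertNumbers.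

(** * Interpolants and bordered determinants *)

Section Bordering.
Context {R : realType} {s : scalars}.
Local Notation K := (scalar_field R s).
Context {X Y : normedModType K}.

Definition extend_from k (A : {linear 'rV[K]_k -> X}) (x : X) (w : 'rV[K]_(1 + k)) : X :=
  lsubmx w ord0 ord0 *: x + A (rsubmx w).

Lemma extend_from_is_linear k (A : {linear 'rV[K]_k -> X}) x :
  linear (extend_from A x).
Proof.
move=> a u v; rewrite /extend_from [lsubmx _]linearP [rsubmx _]linearP [A _]linearP !mxE /=.
rewrite scalerDl scalerDr -scalerA.
by rewrite addrACA.
Qed.
HB.instance Definition _ k (A : {linear 'rV[K]_k -> X}) x :=
  GRing.isLinear.Build K 'rV[K]_(1 + k) X *:%R (extend_from A x)
    (@extend_from_is_linear k A x).

Definition extend_to k (B : {linear Y -> 'rV[K]_k}) (f : {linear Y -> K^o}) (y : Y) :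
  'rV[K]_(1 + k) := row_mx (f y : K)%:M (B y).

Lemma extend_to_is_linear k (B : {linear Y -> 'rV[K]_k}) (f : {linear Y -> K^o}) :
  linear (extend_to B f).
Proof.
move=> a u v; rewrite /extend_to !linearP scale_row_mx add_row_mx.
by rewrite scale_scalar_mx -raddfD.
Qed.
HB.instance Definition _ k (B : {linear Y -> 'rV[K]_k}) (f : {linear Y -> K^o}) :=
  GRing.isLinear.Build K Y 'rV[K]_(1 + k) *:%R (extend_to B f)
    (@extend_to_is_linear k B f).

Variable S : {linear X -> Y}.

(* The Schur complement of [compression S A B] in the matrix of [S] bordered by [x]
   and [f] is [f (S x - interpolant A B x)]. *)
Definition interpolant k (A : {linear 'rV[K]_k -> X}) (B : {linear Y -> 'rV[K]_k}) :
  {linear X -> Y} := S \o (A \o (mulmxr (invmx (compression S A B)) \o (B \o S))).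

(** The inverse of the compression undoes [B S A]. This lets [x] move along the range of [A] without
    changing the error when [X] is a Hilbert space. *)
Lemma interpolantE k (A : {linear 'rV[K]_k -> X}) (B : {linear Y -> 'rV[K]_k}) u :
  \det (compression S A B) != 0 -> interpolant A B (A u) = S (A u).
Proof.
move=> dM; rewrite /interpolant /= -mul_compression mulmxK //.
by rewrite unitmxE unitfE.
Qed.

(** Clears a block in [det_extend], and lets [y] move along the error without changing [B y] when
    [Y] is a Hilbert space. *)
Lemma interpolantBE k (A : {linear 'rV[K]_k -> X}) (B : {linear Y -> 'rV[K]_k}) x :
  \det (compression S A B) != 0 -> B (S x - interpolant A B x) = 0.
Proof.
move=> dM; rewrite linearB /interpolant /= -mul_compression mulmxKV ?subrr //.
by rewrite unitmxE unitfE.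
Qed.

(** The images of the basis vectors under [S A] are independent because [B] maps them to the rows of
    an invertible matrix; all their combinations are attained because the interpolant agrees with
    [S] on the range of [A]. *)
Lemma has_rank_interpolant k (A : {linear 'rV[K]_k -> X}) (B : {linear Y -> 'rV[K]_k}) :
  \det (compression S A B) != 0 -> has_rank (interpolant A B) k.
Proof.
move=> dM; exists (fun i => S (A (delta_mx ord0 i))).
have sumE (c : 'I_k -> K) :
    \sum_(i < k) c i *: S (A (delta_mx ord0 i)) = S (A (\row_i c i)).
  rewrite [\row_i c i]row_sum_delta !linear_sum; apply: eq_bigr => i _.
  by rewrite !linearZ_LR mxE.
split=> [c|].
  rewrite sumE => SA0; have /eqP : \row_i c i *m compression S A B = 0.
    by rewrite mul_compression SA0 linear0.
  move=> /eqP /(congr1 (mulmxr (invmx (compression S A B)))) /=.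
  rewrite mulmxK ?mul0mx ?unitmxE ?unitfE // => /rowP c0 i.
  by have := c0 i; rewrite !mxE.
apply/seteqP; split=> [_ [x _ <-]|_ [c _ <-]]; last first.
  by exists (A (\row_i c i)) => //; rewrite interpolantE // sumE.
rewrite /interpolant /=; set w := _ *m _; exists (fun i => w ord0 i) => //.
rewrite sumE; congr (S (A _)).
by apply/rowP => i; rewrite mxE.
Qed.

(** Adding the combination [v] of the other rows to the first replaces [x] by [x + A v], whose image
    under [S] is the interpolation error. [B] kills it, so the matrix becomes block lower
    triangular. *)
Lemma det_extend k (A : {linear 'rV[K]_k -> X}) (B : {linear Y -> 'rV[K]_k}) x f :
  \det (compression S A B) != 0 ->
  \det (compression S (extend_from A x) (extend_to B f)) =
  f (S x - interpolant A B x) * \det (compression S A B).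
Proof.
move=> dM; set M := compression S A B.
set C := compression S _ _; pose v := - (B (S x) *m invmx M).
have bot (u : 'rV_k) : row_mx 0 u *m C = row_mx (f (S (A u)) : K)%:M (u *m M).
  rewrite mul_compression mul_compression /= /extend_to /extend_from.
  by rewrite row_mxKl row_mxKr mxE scale0r add0r.
have top : row_mx 1%:M v *m C = row_mx (f (S x - interpolant A B x) : K)%:M 0.
  rewrite mul_compression /= /extend_to /extend_from row_mxKl row_mxKr mxE eqxx.
  rewrite scale1r; have -> : S (x + A v) = S x - interpolant A B x.
    by rewrite linearD /v !linearN.
  by rewrite interpolantBE.
have CM : drsubmx C = M.
  apply/row_matrixP => i; rewrite [LHS]rowE [RHS]rowE.
  have := bot (delta_mx 0 i); rewrite -[in LHS](submxK C) mul_row_block.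
  by rewrite !mul0mx !add0r => /eq_row_mx[].
pose P := block_mx 1%:M v 0 1%:M.
have : \det (P *m C) = \det C by rewrite det_mulmx det_ublock !det1 !mul1r.
move=> <-; move: top; rewrite -(submxK C) CM mul_row_block !mul1mx.
move=> /eq_row_mx[top1 top2].
by rewrite mulmx_block !mul1mx !mul0mx !add0r top1 top2 det_lblock det_scalar1.
Qed.

(** Rescaling the bordered maps by [D b a] and [D d c] makes them contractions and multiplies the
    determinant by the weight factors. The weights stay free so that a side with a Hilbert space can
    take both of its weights equal to [1]. *)
Lemma interpolant_le_volume k (A : {linear 'rV[K]_k -> X}) (B : {linear Y -> 'rV[K]_k})
    (x : X) (f : {linear Y -> K^o}) (a b c d : R) : bounded_op S ->
  0 <= a -> 0 <= b -> 0 <= c -> 0 <= d ->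
  \det (compression S A B) != 0 ->
  (forall (u : 'rV[K]_k) t,
    rnorm (scalar_of_real b *: (t *: x) + scalar_of_real a *: A u) ^+ 2 <=
    modulus t ^+ 2 + sqn u) ->
  (forall y, d ^+ 2 * modulus (f y) ^+ 2 + c ^+ 2 * sqn (B y) <= rnorm y ^+ 2) ->
  b * a ^+ k * (d * c ^+ k) * modulus (\det (compression S A B)) *
    modulus (f (S x - interpolant A B x)) <= volume S k.+1.
Proof.
move=> hS a0 b0 c0 d0 dM hA hB.
pose D (p q : R) : 'M[K]_(1 + k) :=
  block_mx (scalar_of_real p)%:M 0 0 (scalar_of_real q)%:M.
have detD p q : 0 <= p -> 0 <= q -> modulus (\det (D p q)) = p * q ^+ k.
  move=> p0 q0; rewrite /D det_ublock !det_scalar expr1 modulusM modulusX.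
  by rewrite !modulus_of_real !ger0_norm.
pose A' : {linear 'rV[K]_(1 + k) -> X} := extend_from A x \o mulmxr (D b a).
pose B' : {linear Y -> 'rV[K]_(1 + k)} := mulmxr (D d c) \o extend_to B f.
have cA : contraction_from A'.
  move=> w; rewrite /A' /=.
  rewrite -[w]hsubmxK mul_row_block !mulmx0 addr0 add0r /extend_from row_mxKl row_mxKr.
  rewrite !mul_mx_scalar linearZ_LR mxE -scalerA (le_trans (hA _ _)) //.
  by rewrite sqn_row_mx lerD2r [lsubmx w]mx11_scalar sqn_scalar mxE eqxx mulr1n.
have cB : contraction_to B'.
  move=> y; rewrite /B' /= (le_trans _ (hB y)) //.
  rewrite mul_row_block !mulmx0 addr0 add0r !mul_mx_scalar sqn_row_mx !sqnZ.
  by rewrite sqn_scalar !modulus_of_real !ger0_norm.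
have := le_volume hS cA cB.
have -> : compression S A' B' =
    D b a *m compression S (extend_from A x) (extend_to B f) *m D d c.
  apply/row_matrixP => i; rewrite [LHS]rowE [RHS]rowE mul_compression.
  by rewrite !mulmxA mul_compression.
rewrite !det_mulmx det_extend // !modulusM !detD //.
by congr (_ <= _); rewrite -!mulrA; congr (_ * _); ring.
Qed.

End Bordering.

(** * From interpolation errors to approximation and Hilbert numbers *)

Section Comparison.
Context {R : realType} {s : scalars}.
Local Notation K := (scalar_field R s).
Context {X Y : normedModType K}.
Variable S : {linear X -> Y}.
Hypothesis hS : bounded_op S.

Lemma approx_number_le_interpolant n k (A : {linear 'rV[K]_k -> X})
    (B : {linear Y -> 'rV[K]_k}) (C : R) : (k <= n)%N -> 0 <= C ->
  \det (compression S A B) != 0 ->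
  (forall x, rnorm x <= 1 -> rnorm (S x - interpolant S A B x) <= C) ->
  approx_number n S <= C.
Proof.
move=> kn C0 dM SC; set L := interpolant S A B.
have SLC x : rnorm ((S \- L) x) <= C * rnorm x.
  have [->|x0] := eqVneq x 0; first by rewrite linear0 !rnorm0 mulr0.
  have rx : 0 < rnorm x.
    by rewrite lt0r rnorm_ge0 andbT; apply: contra_neq x0; exact: rnorm_eq0.
  have ry (V : normedModType K) (z : V) :
      rnorm (scalar_of_real (rnorm x)^-1 *: z) = (rnorm x)^-1 * rnorm z.
    by rewrite rnormZ -/(modulus _) modulus_of_real ger0_norm // invr_ge0 ltW.
  have := SC (scalar_of_real (rnorm x)^-1 *: x).
  rewrite [S _]linearZ_LR [interpolant _ _ _ _]linearZ_LR -scalerBr !ry.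
  rewrite mulVf ?gt_eqF // lexx => /(_ isT).
  by rewrite mulrC ler_pdivrMr.
apply: (le_trans (y := opnorm (S \- L))); last exact: opnorm_le.
apply: (@approx_number_le _ _ _ _ n k) => //; last exact: has_rank_interpolant.
(* [L] is bounded as the difference of [S] and [S - L], which [SLC] controls. *)
have [D D0 SD] := bounded_opP hS.
exists (D + C) => x; rewrite -[L x](subKr (S x)) (le_trans (rnormB _ _)) //.
by rewrite mulrDl; exact: lerD (SD x) (SLC x).
Qed.

Lemma volume_gt0_witness k : 0 < volume S k ->
  exists (A : {linear 'rV[K]_k -> X}) (B : {linear Y -> 'rV[K]_k}),
  [/\ contraction_from A, contraction_to B & \det (compression S A B) != 0].
Proof.
move=> V0; apply: contrapT => h; suff : volume S k <= 0 by rewrite leNgt V0.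
apply: ge_sup; first exact: volumes_nonempty.
move=> _ [A [B [cA cB ->]]]; have [->|d0] := eqVneq (\det (compression S A B)) 0.
  by rewrite modulus0.
by case: h; exists A, B.
Qed.

(** [rho k] is the fraction kept after bordering. Bordering yields [rho_n a_n V_n <= V_(n+1)] and
    [volumeS_le] yields [V_(n+1) <= h_n V_n]; a positive [V_n] cancels. *)
Lemma approx_number_le_hilbert_number (rho : nat -> R) n :
  (forall k, 0 < rho k) ->
  (forall k (A : {linear 'rV[K]_k -> X}) (B : {linear Y -> 'rV[K]_k}) x,
    contraction_from A -> contraction_to B -> \det (compression S A B) != 0 ->
    rnorm x <= 1 ->
    rho k * modulus (\det (compression S A B)) * rnorm (S x - interpolant S A B x)
      <= volume S k.+1) ->
  rho n * approx_number n S <= hilbert_number n S.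
Proof.
move=> rho0 hrho.
have key k (A : {linear 'rV[K]_k -> X}) (B : {linear Y -> 'rV[K]_k}) :
    (k <= n)%N -> contraction_from A -> contraction_to B ->
    rho k * modulus (\det (compression S A B)) * approx_number n S <= volume S k.+1.
  move=> kn cA cB.
  have [->|dM] := eqVneq (\det (compression S A B)) 0.
    by rewrite modulus0 mulr0 mul0r volume_ge0.
  have p0 : 0 < rho k * modulus (\det (compression S A B)).
    by rewrite mulr_gt0 // modulus_gt0.
  rewrite mulrC -ler_pdivlMr //; apply: (approx_number_le_interpolant kn _ dM).
    by rewrite divr_ge0 ?volume_ge0 // ltW.
  by move=> x x1; rewrite ler_pdivlMr // [leLHS]mulrC; exact: hrho.
have a0 := approx_number_ge0 n S.
have [Vn|] := ltP 0 (volume S n).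
  have [->|an] := eqVneq (approx_number n S) 0.
    by rewrite mulr0 hilbert_number_ge0.
  have p0 : 0 < rho n * approx_number n S by rewrite mulr_gt0 // lt0r an.
  (* Solved for the left-hand [volume S n], the inequality bounds a supremum and is checked for each
     pair [A], [B]. *)
  rewrite -(ler_pM2r Vn) mulrC -ler_pdivlMr //; apply: ge_sup.
    exact: volumes_nonempty.
  move=> _ [A [B [cA cB ->]]]; rewrite ler_pdivlMr // mulrA (mulrC _ (rho n)).
  by rewrite (le_trans (key _ _ _ (leqnn n) cA cB)) // volumeS_le.
(* If [volume S n] vanishes, [S] equals an interpolant of smaller rank. *)
move=> Vn.
have [k [kn Vk Vk1]] : exists k, [/\ (k <= n)%N, 0 < volume S k & volume S k.+1 <= 0].
  elim: n Vn {key a0} => [|m IH]; first by rewrite volume0 ler10.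
  move=> Vm; have [Vm0|/IH[k [km Vk Vk1]]] := ltP 0 (volume S m).
    by exists m.
  by exists k; split=> //; rewrite leqW.
have [A [B [cA cB dM]]] := volume_gt0_witness Vk.
have := le_trans (key _ _ _ kn cA cB) Vk1.
rewrite pmulr_rle0 ?mulr_gt0 ?modulus_gt0 // => an.
have -> : approx_number n S = 0 by apply/eqP; rewrite eq_le an.
by rewrite mulr0 hilbert_number_ge0.
Qed.

End Comparison.

(** * Norming functionals *)

Section HahnBanach.
Context {R : realType} {s : scalars}.
Local Notation K := (scalar_field R s).
Context {V : normedModType K}.

Definition sublinear (p : V -> R) :=
  (forall x y, p (x + y) <= p x + p y) /\
  (forall t x, 0 <= t -> p (scalar_of_real t *: x) <= t * p x).

Lemma sublinear_ge (p : V -> R) x : sublinear p -> - p (- x) <= p x.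
Proof.
move=> [pD _]; have := pD 0 0; rewrite addr0 => p0.
by have := pD x (- x); rewrite subrr; lra.
Qed.

(** The closure properties carry subadditivity and homogeneity from near-minimisers to the infimum,
    and [m] keeps it finite. It serves rays in [sublinear_shift] and chains in
    [minimal_sublinear]. *)
Lemma sublinear_inf (F : set (V -> R)) (m : V -> R) : F !=set0 ->
  (forall g x, F g -> m x <= g x) ->
  (forall g h x y, F g -> F h -> exists2 k, F k & k (x + y) <= g x + h y) ->
  (forall g t x, F g -> 0 <= t ->
    exists2 k, F k & k (scalar_of_real t *: x) <= t * g x) ->
  sublinear (fun x => inf [set g x | g in F]) /\
  (forall g x, F g -> inf [set g x | g in F] <= g x).
Proof.
move=> F0 mF FD FZ.
have infF g x : F g -> inf [set g x | g in F] <= g x.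
  by move=> Fg; apply: ge_inf; [exists (m x) => _ [h Fh <-]; exact: mF|exists g].
have F0x x : [set g x | g in F] !=set0 by case: F0 => g Fg; exists (g x), g.
split=> //; split=> [x y|t x t0].
  apply/ler_addgt0Pr => e e0.
  have e2 z : inf [set g z | g in F] < inf [set g z | g in F] + e / 2.
    by rewrite ltrDl divr_gt0.
  have [_ [g Fg <-] gx] := inf_lt (F0x x) (e2 x).
  have [_ [h Fh <-] hy] := inf_lt (F0x y) (e2 y).
  have [k Fk kxy] := FD g h x y Fg Fh.
  by have := infF k (x + y) Fk; lra.
have [->|tn] := eqVneq t 0.
  case: F0 => g Fg; have [k Fk kx] := FZ g 0 x Fg (lexx _).
  by rewrite mul0r (le_trans (infF _ _ Fk)) // (le_trans kx) // mul0r.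
have tp : 0 < t by rewrite lt0r tn.
rewrite -ler_pdivrMl //; apply: lb_le_inf => // _ [g Fg <-].
have [k Fk kx] := FZ g t x Fg t0.
by rewrite ler_pdivrMl // (le_trans (infF _ _ Fk)).
Qed.

(** Take [q x] to be the infimum of [p (x + t y) - t p y] over [t >= 0]; [t = 0] and [t = 1] give
    the two bounds. For a minimal [p] they force [p x + p y <= p (x + y)]. *)
Lemma sublinear_shift (p : V -> R) y : sublinear p ->
  exists q : V -> R, [/\ sublinear q, (forall x, q x <= p x)
    & forall x, q x <= p (x + y) - p y].
Proof.
move=> sp; have [pD pZ] := sp.
pose G t x := p (x + scalar_of_real t *: y) - t * p y.
pose F := [set G t | t in [set t : R | 0 <= t]].
have [||||sq qF] := @sublinear_inf F (fun x => - p (- x)).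
- by exists (G 0), 0 => /=.
- move=> _ x [t /= t0 <-]; rewrite /G.
  have pt : t * p y <= p (scalar_of_real t *: y).
    have [->|tn] := eqVneq t 0.
      rewrite mul0r scalar_of_real0 scale0r.
      by have := pD 0 0; rewrite addr0; lra.
    have tp : 0 < t by rewrite lt0r tn.
    rewrite -ler_pdivlMl // (le_trans _ (pZ _ _ _)) ?invr_ge0 //.
    by rewrite scalerA -scalar_of_realM mulVf // scalar_of_real1 scale1r.
  have := pD (x + scalar_of_real t *: y) (- x); rewrite addrAC subrr add0r; lra.
- move=> _ _ x z [t /= t0 <-] [u /= u0 <-]; exists (G (t + u)).
    by exists (t + u) => //=; rewrite addr_ge0.
  rewrite /G scalar_of_realD scalerDl addrACA.
  by have := pD (x + scalar_of_real t *: y) (z + scalar_of_real u *: y); lra.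
- move=> _ c x [t /= t0 <-] c0; exists (G (c * t)).
    by exists (c * t) => //=; rewrite mulr_ge0.
  rewrite /G scalar_of_realM -scalerA -scalerDr mulrBr mulrA lerD2r.
  exact: pZ.
exists (fun x => inf [set g x | g in F]); split=> // x.
  have /(qF _ x) : F (G 0) by exists 0 => /=.
  by rewrite /G scalar_of_real0 scale0r addr0 mul0r subr0.
have /(qF _ x) : F (G 1) by exists 1 => //=.
by rewrite /G scalar_of_real1 scale1r mul1r.
Qed.

(* A minimal sublinear functional is additive, by [sublinear_shift]. *)
Lemma minimal_sublinear (q0 : V -> R) : sublinear q0 ->
  exists p, [/\ sublinear p, (forall x, p x <= q0 x)
    & forall q, sublinear q -> (forall x, q x <= p x) -> q = p].
Proof.
move=> sq0; pose T := {p : V -> R | sublinear p /\ forall x, p x <= q0 x}.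
(* The order is reversed, so maximal elements are minimal functionals. *)
pose below (p q : T) := `[< forall x, sval q x <= sval p x >].
have [|||A tA|[p [sp pq0]] pmin] := @Zorn T below.
- by move=> p; apply/asboolP => x.
- by move=> p q r /asboolP pq /asboolP qr; apply/asboolP => x; exact: le_trans (pq x).
- move=> [p hp] [q hq] /asboolP pq /asboolP qp; apply: eq_exist.
  by apply/funext => x; apply: le_anti; rewrite (pq x) (qp x).
(* A nonempty chain is bounded by its pointwise infimum, finite because it stays above [- q0 (- x)];
   the empty chain is bounded by [q0]. *)
- have [[p Ap]|A0] := pselect (A !=set0); last first.
    by exists (exist _ q0 (conj sq0 (fun x => lexx (q0 x)))) => p Ap; case: A0; exists p.
  pose F := [set sval g | g in A].
  have [||||sq qF] := @sublinear_inf F (fun x => - q0 (- x)).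
  + by exists (sval p), p.
  + move=> _ x [[g [sg gq]] _ <-] /=; rewrite (le_trans _ (sublinear_ge x sg)) //.
    by rewrite lerN2.
  + move=> _ _ x y [g Ag <-] [h Ah <-].
    have [/asboolP gh|/asboolP hg] := tA g h Ag Ah.
      exists (sval h); first by exists h.
      case: h gh {Ah} => /= h [[hD _] _] gh.
      by rewrite (le_trans (hD _ _)) // lerD2r.
    exists (sval g); first by exists g.
    case: g hg {Ag} => /= g [[gD _] _] hg.
    by rewrite (le_trans (gD _ _)) // lerD2l.
  + move=> _ t x [g Ag <-] t0; exists (sval g); first by exists g.
    by case: g {Ag} => g [[_ gZ] _] /=; exact: gZ.
  have qq0 x : inf [set g x | g in F] <= q0 x.
    apply: (@le_trans _ _ (sval p x)); first by apply: qF; exists p.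
    by case: p {Ap} => p [].
  exists (exist _ (fun x => inf [set g x | g in F]) (conj sq qq0)) => g Ag.
  by apply/asboolP => x /=; apply: qF; exists g.
exists p; split=> // q sq qp.
have qq0 x : q x <= q0 x by exact: le_trans (pq0 x).
have := pmin (exist _ q (conj sq qq0)); rewrite /below => h.
by have [] := h (introT (asboolP _) qp).
Qed.

(** The shift at [y] lowers the norm to a [q0] with [q0 (- y) <= - ||y||], so an additive functional
    below [q0] attains the norm at [y]. A minimal sublinear one is additive, and additivity extends
    homogeneity to negative scalars. *)
Lemma real_norming_functional (y : V) : exists f : V -> R,
  [/\ forall x z, f (x + z) = f x + f z,
      forall t x, f (scalar_of_real t *: x) = t * f x,
      forall x, f x <= rnorm x & f y = rnorm y].
Proof.
have sn : sublinear (@rnorm R s V).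
  split=> [x z|t x t0]; first exact: rnormD.
  by rewrite rnormZ -/(modulus _) modulus_of_real ger0_norm.
have [q0 [sq0 q0n q0y]] := sublinear_shift y sn.
have [f [sf fq0 fmin]] := minimal_sublinear sq0.
have fD x z : f (x + z) = f x + f z.
  have [q [sq qf qz]] := sublinear_shift z sf.
  apply: le_anti; rewrite sf.1 /=.
  by have := qz x; rewrite (fmin q sq qf) lerBrDr.
have f0 : f 0 = 0 by have := fD 0 0; rewrite addr0; lra.
have fN x : f (- x) = - f x by have := fD x (- x); rewrite subrr f0; lra.
have fZ t x : 0 <= t -> f (scalar_of_real t *: x) = t * f x.
  move=> t0; apply: le_anti; rewrite sf.2 //= -lerN2 -fN -scalerN.
  by rewrite (le_trans (sf.2 _ _ t0)) // fN mulrN.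
have fn x : f x <= rnorm x := le_trans (fq0 x) (q0n x).
exists f; split=> // [t x|].
  have [/fZ //|/ltW] := leP 0 t; rewrite -oppr_ge0 => /(fZ _ x).
  by rewrite scalar_of_realN scaleNr fN mulNr => /oppr_inj.
apply: le_anti; rewrite fn /= -[f y]opprK -fN lerNr.
by rewrite (le_trans (fq0 _)) // (le_trans (q0y _)) // addNr rnorm0 sub0r.
Qed.

End HahnBanach.

(** Over the complex numbers [F x = f x - i f (i x)], which is complex linear since [i^2 = -1]; over
    the reals [F = f]. *)
Lemma scalar_re_functional (R : realType) (s : scalars)
    (V : normedModType (scalar_field R s)) (f : V -> R) :
  (forall x z, f (x + z) = f x + f z) ->
  (forall t x, f (scalar_of_real t *: x) = t * f x) ->
  exists F : {linear V -> (scalar_field R s)^o}, forall x, scalar_re (F x) = f x.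
Proof.
case: s V f => V f fD fZ.
  have lF : linear (f : V -> R^o).
    by move=> a x y; rewrite fD; congr (_ + _); exact: fZ.
  pose F : {linear V -> R^o} := HB.pack (f : V -> R^o)
    (GRing.isLinear.Build _ _ _ _ (f : V -> R^o) lF).
  by exists F.
pose K := scalar_field R ComplexScalars; pose J : K := (0 +i* 1)%C.
pose F (x : V) : K^o := (f x +i* - f (J *: x))%C.
have lF : linear F.
  move=> c x y; have [a [b cE]] : exists a b,
      c = scalar_of_real a + scalar_of_real b * J :> K.
    case: c => a b; exists a, b.
    by apply/eqP; rewrite eq_complex /=
      ?(mulr0, mulr1, mul0r, addr0, add0r, subr0, sub0r, oppr0, eqxx).
  have JJ z : J *: (J *: z) = - z :> V.
    rewrite scalerA -scaleN1r; congr (_ *: _).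
    by apply/eqP; rewrite eq_complex /=
      ?(mulr0, mulr1, mul0r, addr0, add0r, subr0, sub0r, oppr0, eqxx).
  have fN z : f (- z) = - f z.
    by have := fZ (-1) z; rewrite scalar_of_realN scalar_of_real1 scaleN1r mulN1r.
  have fc z : f (c *: z) = a * f z + b * f (J *: z).
    by rewrite cE scalerDl fD fZ -scalerA fZ.
  have fJc z : f (J *: (c *: z)) = a * f (J *: z) - b * f z.
    by rewrite scalerA mulrC -scalerA fc JJ fN mulrN.
  rewrite /F scalerDr !fD fc fJc cE; apply/eqP; rewrite eq_complex /=.
  by apply/andP; split; apply/eqP; ring.
pose F' : {linear V -> K^o} := HB.pack F (GRing.isLinear.Build _ _ _ _ F lF).
by exists F'.
Qed.

Lemma norming_functional (R : realType) (s : scalars)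
    (V : normedModType (scalar_field R s)) (y : V) :
  exists2 F : {linear V -> (scalar_field R s)^o},
    forall x, modulus (F x) <= rnorm x & rnorm y <= modulus (F y).
Proof.
have [f [fD fZ fn fy]] := real_norming_functional y.
have [F Ff] := scalar_re_functional fD fZ.
have re_le (a : scalar_field R s) : scalar_re a <= modulus a.
  rewrite -(ler_scalar_of_real (s := s)) modulusE {F Ff fZ f fD fn fy y V}.
  rewrite /scalar_re /scalar_of_real; move: a; case: s => a; first exact: ler_norm.
  by case: a => a b; rewrite normc_def lecR /= (le_trans (ler_norm a)) //
     -sqrtr_sqr ler_wsqrtr // lerDl sqr_ge0.
exists F => [x|]; last by rewrite -fy -Ff.
have [->|Fx0] := eqVneq (F x : scalar_field R s) 0; first by rewrite modulus0 rnorm_ge0.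
(* The phase [u] makes [F (u *: x)] real and equal to the modulus of [F x], so the real bound on [f]
   applies. *)
pose u : scalar_field R s := `|F x| / F x.
have -> : modulus (F x) = f (u *: x).
  rewrite -Ff linearZ_LR /= -[_ *: F x]/(u * F x) /u divfK //.
rewrite (le_trans (fn _)) // rnormZ -/(modulus u) /u modulusM modulusV.
rewrite -modulusE modulus_of_real ger0_norm ?modulus_ge0 // divff ?mul1r //.
by rewrite modulus_eq0.
Qed.

(** * Hilbert spaces and weights *)

Section InnerProduct.
Context {R : realType} {s : scalars}.
Local Notation K := (scalar_field R s).
Context {H : normedModType K} (ip : {dot H for (@scalar_conj R s)}).
Hypothesis ipE : forall x : H, `|x| ^+ 2 = ip x x.

Lemma ip_rnorm x : ip x x = scalar_of_real (rnorm x ^+ 2).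
Proof. by rewrite -ipE -rnormE !expr2 scalar_of_realM. Qed.

Lemma ip_conj x y : ip x y = scalar_conj (ip y x).
Proof. by rewrite hermC expr0 mul1r. Qed.

Lemma ipDl x y z : ip (x + y) z = ip x z + ip y z.
Proof. exact: linearDl. Qed.

Lemma ipBl x y z : ip (x - y) z = ip x z - ip y z.
Proof. exact: linearBl. Qed.

Lemma ipZl a x z : ip (a *: x) z = a * ip x z.
Proof. exact: linearZl_LR. Qed.

Lemma ipDr x y z : ip z (x + y) = ip z x + ip z y.
Proof. exact: linearDr. Qed.

Lemma ipZr a x z : ip z (a *: x) = scalar_conj a * ip z x.
Proof. exact: linearZr_LR. Qed.

Lemma ip_suml k (v : 'I_k -> H) z : ip (\sum_i v i) z = \sum_i ip (v i) z.
Proof. exact: linear_sumlz. Qed.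

Lemma ip_sumr k (v : 'I_k -> H) z : ip z (\sum_i v i) = \sum_i ip z (v i).
Proof. exact: linear_sumr. Qed.

Lemma pythagoras x y : ip x y = 0 -> rnorm (x + y) ^+ 2 = rnorm x ^+ 2 + rnorm y ^+ 2.
Proof.
move=> xy; apply: (scalar_of_real_inj (s := s)); rewrite scalar_of_realD -!ip_rnorm.
by rewrite ipDl !ipDr (ip_conj y x) xy rmorph0 addr0 add0r.
Qed.

(** [u] solves the normal equations, so [A u] is the orthogonal projection of [x] onto the range of
    [A]. The Gram matrix [G] is invertible: a kernel vector [u] would make [A u] orthogonal to
    itself, hence zero. *)
Lemma orthogonal_residual k (A : {linear 'rV[K]_k -> H}) x : injective A ->
  exists u, forall w, ip (x - A u) (A w) = 0.
Proof.
move=> iA; pose e (j : 'I_k) : 'rV[K]_k := delta_mx ord0 j.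
pose G : 'M[K]_k := \matrix_(i, j) ip (A (e i)) (A (e j)).
have AE (w : 'rV[K]_k) : A w = \sum_j w ord0 j *: A (e j).
  rewrite {1}[w]row_sum_delta linear_sum; apply: eq_bigr => j _.
  by rewrite linearZ_LR.
have uG (u : 'rV[K]_k) j : (u *m G) ord0 j = ip (A u) (A (e j)).
  rewrite mxE (AE u) ip_suml; apply: eq_bigr => i _.
  by rewrite ipZl mxE.
have ortho y : (forall j, ip y (A (e j)) = 0) -> forall w, ip y (A w) = 0.
  move=> yA w; rewrite AE ip_sumr big1 // => j _.
  by rewrite ipZr yA mulr0.
have unitG : G \in unitmx.
  rewrite unitmxE unitfE; apply/det0P => -[u u0 uG0].
  have /ortho/(_ u) : forall j, ip (A u) (A (e j)) = 0.
    by move=> j; rewrite -uG uG0 mxE.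
  rewrite ip_rnorm -scalar_of_real0 => /scalar_of_real_inj/eqP.
  rewrite sqrf_eq0 => /eqP/rnorm_eq0 Au0.
  by move: u0; rewrite (iA u 0) ?eqxx // Au0 linear0.
exists (\row_j ip x (A (e j)) *m invmx G) => w; apply: ortho => j.
by rewrite ipBl -uG mulmxKV // mxE subrr.
Qed.

Lemma ip_scaled_is_linear a z : linear (fun y => (a * ip y z : K^o)).
Proof. by move=> c x y; rewrite ipDl ipZl mulrDr mulrCA. Qed.

(** Take [f = <., z> / ||z||]; [a z] is the projection of [y] onto the line of [z], and Pythagoras
    applies. Keeping [y - a *: z] explicit allows [B (y - a *: z) = B y] when [B z = 0]. *)
Lemma hilbert_norming_functional (z : H) : z != 0 ->
  exists2 f : {linear H -> K^o}, modulus (f z) = rnorm z &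
  forall y, exists a : K, rnorm y ^+ 2 = rnorm (y - a *: z) ^+ 2 + modulus (f y) ^+ 2.
Proof.
move=> z0.
have rz : rnorm z != 0 by apply: contra_neq z0; exact: rnorm_eq0.
have rz0 : 0 <= rnorm z := rnorm_ge0 z.
pose r : K := scalar_of_real (rnorm z)^-1.
pose f : {linear H -> K^o} := HB.pack (fun y => (r * ip y z : K^o))
  (GRing.isLinear.Build _ _ _ _ (fun y => (r * ip y z : K^o)) (ip_scaled_is_linear r z)).
have rr : modulus r = (rnorm z)^-1 by rewrite modulus_of_real ger0_norm // invr_ge0.
exists f => [|y].
  rewrite /= modulusM rr ip_rnorm modulus_of_real ger0_norm ?sqr_ge0 //.
  by rewrite expr2 mulKf.
exists (r * f y).
have iyz : ip (y - (r * f y) *: z) ((r * f y) *: z) = 0.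
  rewrite ipZr ipBl ipZl ip_rnorm.
  have rrz : r * (r * scalar_of_real (rnorm z ^+ 2)) = 1.
    rewrite /r -!scalar_of_realM expr2 mulKf // mulVf //; exact: scalar_of_real1.
  have -> : r * f y * scalar_of_real (rnorm z ^+ 2) = ip y z.
    by rewrite -[RHS]mul1r -rrz /=; ring.
  by rewrite subrr mulr0.
have := pythagoras iyz; rewrite subrK => ->; congr (_ + _).
rewrite rnormZ -/(modulus _) modulusM rr exprMn exprMn mulrC mulrA -exprMn.
by rewrite divff // expr1n mul1r.
Qed.

End InnerProduct.

Section Constants.
Context {R : realType}.

(* [p = weight_new k] and [q = weight_old k] maximise [p * q ^+ k] on the circle. *)
Definition weight_old (k : nat) : R := Num.sqrt (k%:R / k.+1%:R).
Definition weight_new (k : nat) : R := Num.sqrt (k.+1%:R^-1).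
Definition weight_det (k : nat) : R := weight_new k * weight_old k ^+ k.

Lemma weightD k : weight_new k ^+ 2 + weight_old k ^+ 2 = 1.
Proof.
rewrite !sqr_sqrtr ?divr_ge0 ?invr_ge0 ?ler0n //.
by rewrite -[X in X + _]mul1r -mulrDl nat1r divff // pnatr_eq0.
Qed.

Lemma weight_det_gt0 k : 0 < weight_det k.
Proof.
rewrite mulr_gt0 // ?sqrtr_gt0 ?invr_gt0 ?ltr0n //.
(* At [k = 0], [weight_old] is [0] but occurs with exponent [0]. *)
case: k => [|k]; first by rewrite expr0.
by rewrite exprn_gt0 // sqrtr_gt0 divr_gt0 ?ltr0n.
Qed.

(** After cancellation this is [(1 + 1/k)^k <= e], the [k]-th power of [1 + 1/k <= expR (1/k)]; for
    [k = 0] it is [1 <= e]. *)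
Lemma weight_det_ge k : 1 <= expR 1 * k.+1%:R * weight_det k ^+ 2.
Proof.
rewrite /weight_det exprMn exprAC !sqr_sqrtr ?divr_ge0 ?invr_ge0 ?ler0n //.
rewrite mulrA mulfK ?pnatr_eq0 //.
case: k => [|k]; first by rewrite expr0 mulr1 (le_trans _ (expR_ge1Dx 1)) // lerDl.
have k0 : 0 < k.+1%:R :> R by rewrite ltr0n.
have -> : expR 1 = expR (k.+1%:R^-1) ^+ k.+1 :> R.
  by rewrite -expRM_natr mulVf // gt_eqF.
rewrite -exprMn exprn_ege1 // mulrA ler_pdivlMr ?ltr0n // mul1r.
apply: le_trans (ler_wpM2r (ltW k0) (expR_ge1Dx _)).
by rewrite mulrDl mul1r mulVf ?gt_eqF // -[k.+2]addn1 natrD.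
Qed.

End Constants.

(** * Interpolation errors for general spaces and for Hilbert spaces, and the resulting
    inequalities *)

Section Main.
Context {R : realType} {s : scalars}.
Local Notation K := (scalar_field R s).
Context {X Y : normedModType K}.
Variable S : {linear X -> Y}.
Hypothesis hS : bounded_op S.

(** Cauchy-Schwarz for the pairs [(b, a)] and [(p, q)], the first being a unit vector by
    [weightD]. *)
Lemma extend_from_weighted k (A : {linear 'rV[K]_k -> X}) x u t :
  contraction_from A -> rnorm x <= 1 ->
  rnorm (scalar_of_real (weight_new k) *: (t *: x) +
    scalar_of_real (weight_old k) *: A u) ^+ 2 <= modulus t ^+ 2 + sqn u.
Proof.
move=> cA x1; set b := weight_new k; set a := weight_old k.
have a0 : 0 <= a by rewrite sqrtr_ge0.
have b0 : 0 <= b by rewrite sqrtr_ge0.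
have ab : b ^+ 2 + a ^+ 2 = 1 := weightD k.
set p := modulus t; set q := rnorm (A u).
have p0 : 0 <= p := modulus_ge0 t; have q0 : 0 <= q := rnorm_ge0 _.
have le_pq : rnorm (scalar_of_real b *: (t *: x) + scalar_of_real a *: A u) <=
    b * p + a * q.
  rewrite (le_trans (rnormD _ _)) // !rnormZ -!/(modulus _) !modulus_of_real.
  by rewrite !ger0_norm // lerD2r ler_wpM2l // -[leRHS]mulr1 ler_wpM2l.
apply: (le_trans (y := (b * p + a * q) ^+ 2)).
  by rewrite lerXn2r ?nnegrE ?rnorm_ge0 // addr_ge0 // mulr_ge0.
apply: le_trans (_ : p ^+ 2 + q ^+ 2 <= _); last by rewrite lerD2l cA.
rewrite -[leRHS]mul1r -ab -subr_ge0.
by rewrite (_ : _ - _ = (b * q - a * p) ^+ 2) ?sqr_ge0 //; ring.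
Qed.

Lemma extend_to_weighted k (B : {linear Y -> 'rV[K]_k}) (f : {linear Y -> K^o}) y :
  contraction_to B -> modulus (f y) <= rnorm y ->
  weight_new k ^+ 2 * modulus (f y) ^+ 2 + weight_old k ^+ 2 * sqn (B y) <=
    rnorm y ^+ 2.
Proof.
move=> cB fy; rewrite -[leRHS]mul1r -(weightD k) mulrDl lerD // ler_wpM2l ?sqr_ge0 //.
by rewrite lerXn2r ?nnegrE ?modulus_ge0 ?rnorm_ge0.
Qed.

(** Without orthogonality, weights are paid on both sides, whence the square of [weight_det]; [f]
    norms the error. *)
Lemma interpolant_le_weighted k (A : {linear 'rV[K]_k -> X})
    (B : {linear Y -> 'rV[K]_k}) x :
  contraction_from A -> contraction_to B -> \det (compression S A B) != 0 ->
  rnorm x <= 1 ->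
  weight_det k ^+ 2 * modulus (\det (compression S A B)) *
    rnorm (S x - interpolant S A B x) <= volume S k.+1.
Proof.
move=> cA cB dM x1.
have [f fn fz] := norming_functional (S x - interpolant S A B x).
have := @interpolant_le_volume _ _ _ _ S k A B x f (weight_old k) (weight_new k)
  (weight_old k) (weight_new k) hS.
rewrite !sqrtr_ge0 => /(_ isT isT isT isT dM) h.
apply: le_trans (h _ _).
- rewrite -!/(weight_det k) -expr2 ler_wpM2l // mulr_ge0 ?modulus_ge0 //.
  by rewrite exprn_ge0 // ltW // weight_det_gt0.
- by move=> u t; exact: extend_from_weighted.
by move=> y; apply: extend_to_weighted.
Qed.

(** Subtracting from [x] its projection onto the range of [A] changes neither the error nor the norm
    bound, and Pythagoras then allows weights [1] on the domain side. *)
Lemma interpolant_le_hilbert_domain k (A : {linear 'rV[K]_k -> X})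
    (B : {linear Y -> 'rV[K]_k}) x : is_hilbert X ->
  contraction_from A -> contraction_to B -> \det (compression S A B) != 0 ->
  rnorm x <= 1 ->
  weight_det k * modulus (\det (compression S A B)) *
    rnorm (S x - interpolant S A B x) <= volume S k.+1.
Proof.
move=> [_ [ip ipE]] cA cB dM x1.
have iA : injective A.
  move=> u v Auv; have : u *m compression S A B = v *m compression S A B.
    by rewrite !mul_compression Auv.
  by apply: (can_inj (mulmxK _)); rewrite unitmxE unitfE.
have [u ou] := orthogonal_residual ipE x iA.
pose x' := x - A u.
have -> : S x - interpolant S A B x = S x' - interpolant S A B x'.
  by rewrite /x' [S (x - _)]linearB [interpolant _ _ _ (x - _)]linearB interpolantE //
    opprB addrA subrK.
have x'1 : rnorm x' <= 1.
  rewrite (le_trans _ x1) // -ler_sqr ?nnegrE ?rnorm_ge0 //.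
  have := pythagoras ipE (ou u); rewrite subrK => ->.
  by rewrite lerDl sqr_ge0.
have [f fn fz] := norming_functional (S x' - interpolant S A B x').
have := @interpolant_le_volume _ _ _ _ S k A B x' f 1 1
  (weight_old k) (weight_new k) hS.
rewrite !sqrtr_ge0 !ler01 => /(_ isT isT isT isT dM) h.
apply: le_trans (h _ _).
- rewrite expr1n !mul1r -/(weight_det k) ler_wpM2l // mulr_ge0 ?modulus_ge0 //.
  by rewrite ltW // weight_det_gt0.
- move=> w t; rewrite scalar_of_real1 !scale1r (pythagoras ipE); last first.
    by rewrite ipZl ou mulr0.
  rewrite lerD ?cA // rnormZ -/(modulus _) exprMn -[leRHS]mulr1.
  by rewrite ler_wpM2l ?sqr_ge0 // expr_le1 ?rnorm_ge0.
by move=> y; apply: extend_to_weighted.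
Qed.

(** The error [z] lies in the kernel of [B], so with [f = <., z> / ||z||] Pythagoras allows weights
    [1] on the codomain side. *)
Lemma interpolant_le_hilbert_codomain k (A : {linear 'rV[K]_k -> X})
    (B : {linear Y -> 'rV[K]_k}) x : is_hilbert Y ->
  contraction_from A -> contraction_to B -> \det (compression S A B) != 0 ->
  rnorm x <= 1 ->
  weight_det k * modulus (\det (compression S A B)) *
    rnorm (S x - interpolant S A B x) <= volume S k.+1.
Proof.
move=> [_ [ip ipE]] cA cB dM x1; set z := S x - _.
have [->|z0] := eqVneq z 0; first by rewrite rnorm0 mulr0 volume_ge0.
have [f fz fy] := hilbert_norming_functional ipE z0.
have := @interpolant_le_volume _ _ _ _ S k A B x f (weight_old k) (weight_new k) 1 1 hS.
rewrite !sqrtr_ge0 !ler01 => /(_ isT isT isT isT dM) h.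
apply: le_trans (h _ _).
- by rewrite expr1n !mulr1 fz.
- by move=> u t; exact: extend_from_weighted.
move=> y; rewrite expr1n !mul1r; have [a ->] := fy y.
rewrite addrC lerD2r -[B y]subr0 -(scaler0 _ a) -(interpolantBE x dM).
by rewrite -linearZ_LR -linearB cB.
Qed.

End Main.

Theorem theorem1 (R : realType) (s : scalars)
    (X Y : normedModType (scalar_field R s))
    (S : {linear X -> Y}) (hS : bounded_op S) (n : nat) :
  approx_number n S <= expR 1 * n.+1%:R * hilbert_number n S /\
  (is_hilbert X \/ is_hilbert Y ->
   approx_number n S <= Num.sqrt (expR 1 * n.+1%:R) * hilbert_number n S).
Proof.
have a0 := approx_number_ge0 n S.
have c0 : 0 <= expR 1 * n.+1%:R :> R by rewrite mulr_ge0 ?expR_ge0 ?ler0n.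
have w0 k : 0 < weight_det k :> R := weight_det_gt0 k.
split=> [|hXY].
  have h : weight_det n ^+ 2 * approx_number n S <= hilbert_number n S.
    apply: (approx_number_le_hilbert_number hS (rho := fun k => weight_det k ^+ 2)).
      by move=> k; rewrite exprn_gt0.
    by move=> k A B x cA cB dM x1; exact: interpolant_le_weighted.
  (* By [weight_det_ge], multiplying [h] by [e (n+1)] leaves a left factor of at least [1]. *)
  rewrite (le_trans _ (ler_wpM2l c0 h)) // mulrA -[leLHS]mul1r.
  by rewrite ler_wpM2r // weight_det_ge.
have h : weight_det n * approx_number n S <= hilbert_number n S.
  apply: (approx_number_le_hilbert_number hS) => // k A B x cA cB dM x1.
  case: hXY => hH; first exact: interpolant_le_hilbert_domain.
  exact: interpolant_le_hilbert_codomain.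
rewrite (le_trans _ (ler_wpM2l (sqrtr_ge0 _) h)) // mulrA -[leLHS]mul1r.
have -> : weight_det n = Num.sqrt (weight_det n ^+ 2) :> R.
  by rewrite sqrtr_sqr ger0_norm // ltW.
by rewrite ler_wpM2r // -sqrtrM // -[leLHS]sqrtr1 ler_wsqrtr // weight_det_ge.
Qed.
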